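(* Let $A$ be a finite set, let $(k_\alpha)_{\alpha\in A}$ be local fields of characteristic $0$, and for each $\alpha\in A$ let $\mathbb{G}_\alpha$ be an almost $k_\alpha$-simple algebraic group defined over $k_\alpha$ of $k_\alpha$-rank $\geq 2$. Let $\Lambda$ be a $\star$-approximate lattice in $G_A:=\prod_{\alpha\in A}\mathbb{G}_\alpha(k_\alpha)$, and let $\nu$ be a proper $G_A$-invariant ergodic Borel probability measure on $\Omega^{ext}_\Lambda$. Let $s:\Omega^{ext}_\Lambda\setminus\{\emptyset\}\to G_A$ be a Borel map with $s(X)\in X$ for all $X$, and let $\alpha_s(g,X):=s(gX)^{-1}g\,s(X)$ be the associated cocycle, which takes values in $\Lambda^2\subset\langle\Lambda\rangle$. Let $H$ be a locally compact second countable group and $T:\langle\Lambda\rangle\to H$ an (abstract) group homomorphism. Suppose that the cocycle $T\circ\alpha_s$ over $(\Omega^{ext}_\Lambda,\nu)$ is cohomologous to a cocycle taking values in a closed subgroup $L\subset H$. Then there is $h\in H$ such that for every neighbourhood of the identity $\mathcal{V}\subset H$ there is $\Lambda'\subset\Lambda^2$ commensurable to $\Lambda$ such that $$T(\Lambda')\subset\mathcal{V}hLh^{-1}\mathcal{V}^{-1}.$$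
   Context: Almost simple algebraic groups are connected and linear. For subsets $X,Y$ of a group $G$, $XY=\{xy : x\in X,y\in Y\}$, $X^{-1}=\{x^{-1}:x\in X\}$, $X^n$ is the $n$-fold product set, and $\langle X\rangle$ is the subgroup generated by $X$. An approximate subgroup of $G$ is a subset $X\ni e$ with $X=X^{-1}$ and $X^2\subset FX$ for some finite $F\subset G$. Two subsets $\Lambda_1,\Lambda_2$ of $G$ are commensurable if there is a finite $F\subset G$ with $\Lambda_i\subset F\Lambda_j\cap\Lambda_jF$ for $i\neq j\in\{1,2\}$. For a locally compact second countable group $G$, a subset $X$ is uniformly discrete if $e$ is isolated in $X^{-1}X$. $\mathcal{C}(G)$ is the set of closed subsets of $G$ with the Chabauty--Fell topology, generated by the sets $U_K=\{C : C\cap K=\emptyset\}$ ($K\subset G$ compact) and $U^V=\{C: C\cap V\neq\emptyset\}$ ($V\subset G$ open); it is a compact metrizable $G$-space under $(g,X)\mapsto gX$. The extended invariant hull of a closed subset $X_0$ is the closed $G$-invariant set $\Omega^{ext}_{X_0}=\{X\in\mathcal{C}(G): X^{-1}X\subset\overline{X_0^{-1}X_0}\}$. A Borel probability measure $\nu$ on it is proper if $\nu(\{\emptyset\})=0$. A $\star$-approximate lattice in $G$ is a uniformly discrete approximate subgroup $\Lambda$ such that $\Omega^{ext}_\Lambda$ carries a proper $G$-invariant Borel probability measure. Two Borel cocycles $\alpha,\beta:G\times\Omega\to H$ over a $G$-space $(\Omega,\nu)$ are cohomologous if there is a Borel map $\phi:\Omega\to H$ such that for all $g\in G$ and $\nu$-almost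 every $x$, $\alpha(g,x)=\phi(gx)\beta(g,x)\phi(x)^{-1}$. *)

(* Defs.v *)
From HB Require Import structures.
From mathcomp Require Import all_boot all_order all_algebra.
From mathcomp Require Import all_classical all_reals all_analysis.
From mathcomp Require Import -(notations) mpoly.

Set Implicit Arguments.
Unset Strict Implicit.
Unset Printing Implicit Defensive.

Import Order.TTheory GRing.Theory Num.Theory.

Local Open Scope classical_set_scope.
Local Open Scope ring_scope.

HB.mixin Record isTopologicalGroup G & Topological G & Group G := {
  mulg_continuous : continuous (fun x : G * G => (x.1 * x.2)%g) ;
  invg_continuous : continuous (fun x : G => (x^-1)%g) ;
}.

#[short(type="topGroupType")]
HB.structure Definition TopologicalGroup :=
  {G of Pointed G & Topological G & Group G & isTopologicalGroup G}.

Definition lcsc (G : topGroupType) : Prop :=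
  [/\ hausdorff_space G, locally_compact [set: G] & @second_countable G].

HB.mixin Record TopologicalZmodule_isTopologicalField F
    & TopologicalZmodule F & GRing.Field F := {
  mulf_continuous : continuous (fun x : F * F => x.1 * x.2) ;
  invf_continuous : forall x : F, x != 0 -> {for x, continuous (@GRing.inv F)} ;
}.

#[short(type="topFieldType")]
HB.structure Definition TopologicalField :=
  {F of TopologicalZmodule F & GRing.Field F
      & TopologicalZmodule_isTopologicalField F}.

Definition local_field (k : topFieldType) : Prop :=
  [/\ hausdorff_space k, locally_compact [set: k] & ~ open [set 0 : k]].

Section Subsets.
Variable G : groupType.
Implicit Types X Y F : set G.
Local Open Scope group_scope.

Definition setmulg X Y : set G := [set x * y | x in X & y in Y].
Definition setinvg X : set G := [set x^-1 | x in X].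

Definition is_subgroup X : Prop :=
  [/\ X 1, forall x y, X x -> X y -> X (x * y) & forall x, X x -> X x^-1].

Definition generated X : set G := smallest is_subgroup X.

(* A homomorphism <X> -> H; the values of T outside <X> are irrelevant. *)
Definition hom_on_generated (H : groupType) X (T : G -> H) : Prop :=
  forall x y, generated X x -> generated X y -> T (x * y) = T x * T y.

Definition approximate_subgroup X : Prop :=
  [/\ X 1, setinvg X = X
    & exists F, finite_set F /\ setmulg X X `<=` setmulg F X].

Definition commensurable X Y : Prop :=
  exists F, [/\ finite_set F,
    X `<=` setmulg F Y `&` setmulg Y F & Y `<=` setmulg F X `&` setmulg X F].

End Subsets.

Section ChabautyFell.
Variable G : topologicalType.

Definition closedSpace : Type := {X : set G | closed X}.

HB.instance Definition _ := gen_eqMixin closedSpace.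
HB.instance Definition _ := gen_choiceMixin closedSpace.

Definition closed_empty : closedSpace := exist _ set0 (@closed0 G).

HB.instance Definition _ := isPointed.Build closedSpace closed_empty.

Definition chabauty_fell_subbase : set (set closedSpace) :=
  [set [set C | sval C `&` K = set0] | K in compact] `|`
  [set [set C | sval C `&` V !=set0] | V in open].

HB.instance Definition _ :=
  isSubBaseTopological.Build closedSpace chabauty_fell_subbase id.

End ChabautyFell.

Section Translation.
Variable G : topGroupType.

Lemma closed_translate (g : G) (X : closedSpace G) :
  closed [set (g * x)%g | x in sval X].
Proof.
have -> : [set (g * x)%g | x in sval X] = (fun x => (g^-1 * x)%g) @^-1` sval X.
  apply/seteqP; split => [_ [x Xx <-]|x Xx] /=; first by rewrite mulKg.
  by exists (g^-1 * x)%g; rewrite ?mulVKg.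
apply: preimage_closed; last exact: (svalP X).
move=> x _.
apply: (@continuous_comp _ _ _ (fun x => (g^-1, x)%g)
  (fun x : G * G => (x.1 * x.2)%g)); last exact: mulg_continuous.
by apply: cvg_pair => /=; [exact: cvg_cst|exact: cvg_id].
Qed.

Definition translate (g : G) (X : closedSpace G) : closedSpace G :=
  exist _ _ (@closed_translate g X).

End Translation.

Notation borel T := (g_sigma_algebraType (@open T)).

(* A Borel measure on a closed subset Omega of [closedSpace G] is represented
   by a Borel measure on [closedSpace G] that gives full mass to Omega. *)
Section Hull.
Variables (R : realType) (G : topGroupType).
Implicit Types (X : set G) (nu : probability (borel (closedSpace G)) R).

Definition uniformly_discrete X : Prop :=
  isolated (setmulg (setinvg X) X) 1%g.

Definition extended_hull X : set (closedSpace G) :=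
  [set C | setmulg (setinvg (sval C)) (sval C)
             `<=` closure (setmulg (setinvg X) X)].

Definition proper_measure nu : Prop := nu [set closed_empty G] = 0%E.

Definition invariant_measure nu : Prop :=
  forall (g : G) (B : set (borel (closedSpace G))), measurable B ->
    nu (translate g @^-1` B) = nu B.

Definition ergodic_measure nu : Prop :=
  forall B : set (borel (closedSpace G)), measurable B ->
    (forall g : G, translate g @^-1` B = B) -> nu B = 0%E \/ nu B = 1%E.

Definition star_approximate_lattice X : Prop :=
  [/\ approximate_subgroup X, uniformly_discrete X
    & exists nu, [/\ nu (extended_hull X) = 1%E, proper_measure nu
                   & invariant_measure nu]].

End Hull.

(* Maps defined on Omega (or on the group times Omega) are represented by total
   functions; since nu is concentrated on Omega, their values outside Omega are
   irrelevant, and measurability is only required on Omega. *)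
Section Cocycles.
Variables (R : realType) (G H : topGroupType) (Omega : set (closedSpace G)).
Variable nu : probability (borel (closedSpace G)) R.
Implicit Types alpha beta : G -> closedSpace G -> H.

Definition borel_cocycle alpha : Prop :=
  measurable_fun (setT `*` Omega : set (borel (G * closedSpace G)%type))
    (fun gx => alpha gx.1 gx.2 : borel H) /\
  forall g h : G, \forall x \ae nu,
    alpha (g * h)%g x = (alpha g (translate h x) * alpha h x)%g.

Definition cohomologous alpha beta : Prop :=
  exists phi : closedSpace G -> H,
    measurable_fun (Omega : set (borel (closedSpace G))) (phi : _ -> borel H) /\
    forall g : G, \forall x \ae nu,
      alpha g x = (phi (translate g x) * beta g x * (phi x)^-1)%g.

Definition values_in alpha (L : set H) : Prop :=
  forall g x, Omega x -> L (alpha g x).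

Definition pointed_section (s : closedSpace G -> G) : Prop :=
  measurable_fun (Omega `\ closed_empty G : set (borel (closedSpace G)))
    (s : _ -> borel G) /\
  forall X, Omega X -> X <> closed_empty G -> sval X (s X).

Definition section_cocycle (s : closedSpace G -> G) (g : G)
    (X : closedSpace G) : G :=
  ((s (translate g X))^-1 * g * s X)%g.

End Cocycles.

(* Linear algebraic groups over k in the language of Borel: subgroups of GL_n(K),
   K an algebraically closed extension of k, cut out by polynomials over k in the
   matrix entries. For k perfect, in particular in characteristic 0, being
   k-closed in this sense is the same as being defined over k. *)
Section AlgebraicGroups.
Variables (k : fieldType) (K : closedFieldType) (iota : {rmorphism k -> K}).

Definition poly_eval n (p : mpoly (n * n) k) (g : 'M[K]_n) : K :=
  mmap iota (mxvec g 0) p.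

Definition zariski_closed n (X : set 'M[K]_n) : Prop :=
  exists I : set (mpoly (n * n) k),
    X = [set g | g \in unitmx /\ forall p, I p -> poly_eval p g = 0].

Record algebraic_group n := AlgebraicGroup {
  alg_set :> set 'M[K]_n ;
  alg_closed : zariski_closed alg_set ;
  alg1 : alg_set 1%:M ;
  algM : forall x y, alg_set x -> alg_set y -> alg_set (x *m y) ;
  algV : forall x, alg_set x -> alg_set (invmx x)
}.

Lemma alg_unitmx n (G : algebraic_group n) g : alg_set G g -> g \in unitmx.
Proof. by have [I ->] := alg_closed G; case. Qed.

(* The coordinate ring of GL_n over k is k[x_ij, 1/det]. *)
Definition regular_map n m (X : set 'M[K]_n) (f : 'M[K]_n -> 'M[K]_m) : Prop :=
  forall i j, exists (p : mpoly (n * n) k) (d : nat),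
    forall x, X x -> f x i j = poly_eval p x / \det x ^+ d.

Definition isomorphic_over n m (X : set 'M[K]_n) (Y : set 'M[K]_m) : Prop :=
  exists (f : 'M[K]_n -> 'M[K]_m) (g : 'M[K]_m -> 'M[K]_n),
    [/\ regular_map X f /\ regular_map Y g,
        {homo f : x / X x >-> Y x} /\ {homo g : y / Y y >-> X y},
        forall x, X x -> g (f x) = x, forall y, Y y -> f (g y) = y
      & forall x y, X x -> X y -> f (x *m y) = f x *m f y].

Definition diagonal_group d : set 'M[K]_d :=
  [set x | is_diag_mx x /\ x \in unitmx].
Arguments diagonal_group : clear implicits.

Definition split_torus n (S : algebraic_group n) d : Prop :=
  isomorphic_over S (diagonal_group d).

(* r is the k-rank: the largest dimension of a k-split torus contained in G. *)
Definition is_rank n (G : algebraic_group n) r : Prop :=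
  (exists S : algebraic_group n, S `<=` G /\ split_torus S r) /\
  forall (S : algebraic_group n) d, S `<=` G -> split_torus S d -> (d <= r)%N.

Definition normal_in n (N G : algebraic_group n) : Prop :=
  N `<=` G /\
    forall g x, alg_set G g -> alg_set N x -> alg_set N (g *m x *m invmx g).

End AlgebraicGroups.

Definition zariski_connected (K : closedFieldType) n (X : set 'M[K]_n) : Prop :=
  forall Y Z : set 'M[K]_n,
    zariski_closed idfun Y -> zariski_closed idfun Z ->
    X = Y `|` Z -> Y `&` Z = set0 -> Y = set0 \/ Z = set0.

Definition almost_simple (k : fieldType) (K : closedFieldType)
    (iota : {rmorphism k -> K}) n (G : algebraic_group iota n) : Prop :=
  [/\ zariski_connected G,
      exists x y, [/\ alg_set G x, alg_set G y & x *m y != y *m x]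
    & forall N : algebraic_group iota n,
        normal_in N G -> (N : set 'M[K]_n) <> G -> finite_set N].

Section MatrixContinuity.

Lemma mx_entry_continuous (T : topologicalType) m n i j :
  continuous (fun M : 'M[T]_(m, n) => M i j).
Proof.
move=> M P MP; exists (fun i' j' => [set x | i' = i /\ j' = j -> P x]).
  move=> i' j'; have [[-> ->]|ij] := pselect (i' = i /\ j' = j).
    by apply: filterS MP => x Px _.
  by apply: filterS filterT => x _ /ij.
by move=> N /(_ i j) /=; apply.
Qed.

Lemma mx_continuous (X T : topologicalType) m n (f : X -> 'M[T]_(m, n)) :
  (forall i j, continuous (fun x => f x i j)) -> continuous f.
Proof.
move=> fC x P [Q fQ QP].
have : \forall y \near x, forall i j, Q i j (f y i j).
  by apply: filter_forall => i; apply: filter_forall => j; exact: fC (fQ i j).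
by apply: filterS => y /= yQ; exact: QP.
Qed.

Variables (k : topFieldType) (X : topologicalType).

Lemma continuous_mulf (f g : X -> k) :
  continuous f -> continuous g -> continuous (fun x => f x * g x).
Proof.
move=> fC gC x; apply: (@continuous_comp _ _ _ (fun x => (f x, g x))
  (fun y : k * k => y.1 * y.2)); last exact: mulf_continuous.
by apply: cvg_pair => /=; [exact: fC|exact: gC].
Qed.

Lemma continuous_entry m n (f : X -> 'M[k]_(m, n)) i j :
  continuous f -> continuous (fun x => f x i j).
Proof.
move=> fC x; apply: (@continuous_comp _ _ _ f (fun M : 'M[k]_(m, n) => M i j)).
  exact: fC.
exact: mx_entry_continuous.
Qed.

Lemma continuous_mulmx m n p (f : X -> 'M[k]_(m, n)) (g : X -> 'M[k]_(n, p)) :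
  continuous f -> continuous g -> continuous (fun x => f x *m g x).
Proof.
move=> fC gC; apply: mx_continuous => i j.
under eq_fun do rewrite mxE.
apply: continuous_big => [|l _]; first exact: add_continuous.
by apply: continuous_mulf; exact: continuous_entry.
Qed.

Lemma continuous_det n (f : X -> 'M[k]_n) :
  continuous f -> continuous (fun x => \det (f x)).
Proof.
move=> fC; apply: continuous_big => [|s _]; first exact: add_continuous.
apply: continuous_mulf; first by move=> x; exact: cvg_cst.
apply: continuous_big => [|i _]; first exact: mulf_continuous.
exact: continuous_entry.
Qed.

Lemma continuous_invmx n (f : X -> 'M[k]_n) :
  (forall x, f x \in unitmx) -> continuous f ->
  continuous (fun x => invmx (f x)).
Proof.
move=> fU fC; apply: mx_continuous => i j.
under eq_fun => x do rewrite /invmx fU !mxE /cofactor.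
apply: continuous_mulf.
  move=> x; apply: (@continuous_comp _ _ _ (fun x => \det (f x)) GRing.inv).
    exact: continuous_det.
  by apply: invf_continuous; rewrite -unitfE; have := fU x; rewrite unitmxE.
apply: continuous_mulf; first by move=> x; exact: cvg_cst.
apply: continuous_det; apply: mx_continuous => i' j'.
under eq_fun do rewrite !mxE.
exact: continuous_entry.
Qed.

End MatrixContinuity.

Section RationalPoints.
Variables (k : topFieldType) (K : closedFieldType) (iota : {rmorphism k -> K}).
Variables (n : nat) (G : algebraic_group iota n).

Definition rational_point : Type :=
  set_type [set x : 'M[k]_n | alg_set G (map_mx iota x)].

HB.instance Definition _ := Topological.on rational_point.

Implicit Types x y z : rational_point.

Lemma rational_pointP x : alg_set G (map_mx iota (\val x)).
Proof. exact: set_mem (valP x). Qed.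

Definition mk_point (a : 'M[k]_n) (Ga : alg_set G (map_mx iota a)) : rational_point :=
  exist _ a (mem_set Ga).

Lemma rational_unit x : \val x \in unitmx.
Proof.
by rewrite -(map_unitmx iota); exact: alg_unitmx (rational_pointP x).
Qed.

Lemma point1_subproof : alg_set G (map_mx iota 1%:M).
Proof. by rewrite map_mx1; exact: alg1. Qed.

Lemma pointM_subproof x y : alg_set G (map_mx iota (\val x *m \val y)).
Proof. by rewrite map_mxM; apply: algM; exact: rational_pointP. Qed.

Lemma pointV_subproof x : alg_set G (map_mx iota (invmx (\val x))).
Proof. by rewrite map_invmx; apply: algV; exact: rational_pointP. Qed.

Definition point1 := mk_point point1_subproof.
Definition pointM x y := mk_point (pointM_subproof x y).
Definition pointV x := mk_point (pointV_subproof x).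

Lemma pointMA : associative pointM.
Proof. by move=> x y z; apply: val_inj; rewrite /= mulmxA. Qed.
Lemma point1M : left_id point1 pointM.
Proof. by move=> x; apply: val_inj; rewrite /= mul1mx. Qed.
Lemma pointM1 : right_id point1 pointM.
Proof. by move=> x; apply: val_inj; rewrite /= mulmx1. Qed.
Lemma pointVM : left_inverse point1 pointV pointM.
Proof. by move=> x; apply: val_inj; rewrite /= mulVmx ?rational_unit. Qed.
Lemma pointMV : right_inverse point1 pointV pointM.
Proof. by move=> x; apply: val_inj; rewrite /= mulmxV ?rational_unit. Qed.

HB.instance Definition _ := isGroup.Build rational_point
  pointMA point1M pointM1 pointVM pointMV.
HB.instance Definition _ := isPointed.Build rational_point point1.

Lemma val_point_continuous : continuous (\val : rational_point -> 'M[k]_n).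
Proof.
have -> : \val = (set_val : rational_point -> 'M[k]_n).
  by apply/funext => x; rewrite set_valE.
exact: initial_continuous.
Qed.

Lemma continuous_point (X : topologicalType) (f : X -> rational_point) :
  continuous (fun t => \val (f t)) -> continuous f.
Proof.
move=> fC; apply/continuousP => _ [B oB <-]; rewrite set_valE.
by move/continuousP : fC; exact.
Qed.

Lemma pointM_continuous :
  continuous (fun x : rational_point * rational_point => (x.1 * x.2)%g).
Proof.
apply: continuous_point; apply: continuous_mulmx => x.
  by apply: (@continuous_comp _ _ _ fst (\val : rational_point -> 'M[k]_n));
    [exact: cvg_fst|exact: val_point_continuous].
by apply: (@continuous_comp _ _ _ snd (\val : rational_point -> 'M[k]_n));
  [exact: cvg_snd|exact: val_point_continuous].
Qed.

Lemma pointV_continuous : continuous (fun x : rational_point => (x^-1)%g).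
Proof.
apply: continuous_point; apply: continuous_invmx; first exact: rational_unit.
exact: val_point_continuous.
Qed.

HB.instance Definition _ :=
  isTopologicalGroup.Build rational_point pointM_continuous pointV_continuous.

End RationalPoints.

Section ProductGroup.
Variables (I : Type) (G : I -> topGroupType).

Definition product_group : Type := prod_topology G.

HB.instance Definition _ := Topological.on product_group.

Implicit Types x y z : product_group.

Definition product1 : product_group := fun=> 1%g.
Definition productM x y : product_group := fun i => (x i * y i)%g.
Definition productV x : product_group := fun i => ((x i)^-1)%g.

Lemma productMA : associative productM.
Proof. by move=> x y z; apply/functional_extensionality_dep => i; exact: mulgA. Qed.
Lemma product1M : left_id product1 productM.
Proof. by move=> x; apply/functional_extensionality_dep => i; exact: mul1g. Qed.
Lemma productM1 : right_id product1 productM.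
Proof. by move=> x; apply/functional_extensionality_dep => i; exact: mulg1. Qed.
Lemma productVM : left_inverse product1 productV productM.
Proof. by move=> x; apply/functional_extensionality_dep => i; exact: mulVg. Qed.
Lemma productMV : right_inverse product1 productV productM.
Proof. by move=> x; apply/functional_extensionality_dep => i; exact: mulgV. Qed.

HB.instance Definition _ := isGroup.Build product_group
  productMA product1M productM1 productVM productMV.
HB.instance Definition _ := isPointed.Build product_group product1.

Lemma coordinate_continuous i : continuous (fun x : product_group => x i).
Proof.
move=> x P xP; have /cvg_sup/(_ i) xx : nbhs x --> (x : product_topology_def G).
  exact: cvg_id.
by apply: xx; exact: (@initial_continuous _ _ (fun f : product_group => f i)).
Qed.

Lemma continuous_product (X : topologicalType) (f : X -> product_group) :
  (forall i, continuous (fun t => f t i)) -> continuous f.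
Proof.
move=> fC t; apply/cvg_sup => i.
move: t; apply/(@continuousP _ (initial_topology (fun g : product_group => g i))).
by move=> _ [B oB <-]; move/continuousP : (fC i); exact.
Qed.

Lemma productM_continuous :
  continuous (fun x : product_group * product_group => (x.1 * x.2)%g).
Proof.
apply: continuous_product => i x.
apply: (@continuous_comp _ _ _
  (fun x : product_group * product_group => (x.1 i, x.2 i))
  (fun y : G i * G i => (y.1 * y.2)%g)); last exact: mulg_continuous.
apply: cvg_pair => /=.
  by apply: (@continuous_comp _ _ _ fst (fun z : product_group => z i));
    [exact: cvg_fst|exact: coordinate_continuous].
by apply: (@continuous_comp _ _ _ snd (fun z : product_group => z i));
  [exact: cvg_snd|exact: coordinate_continuous].
Qed.

Lemma productV_continuous : continuous (fun x : product_group => (x^-1)%g).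
Proof.
apply: continuous_product => i x.
by apply: (@continuous_comp _ _ _ (fun z : product_group => z i)
  (fun y : G i => (y^-1)%g));
  [exact: coordinate_continuous|exact: invg_continuous].
Qed.

HB.instance Definition _ := isTopologicalGroup.Build product_group
  productM_continuous productV_continuous.

End ProductGroup.

Definition product_of_points (A : finType) (k : A -> topFieldType)
    (K : A -> closedFieldType) (iota : forall a, {rmorphism k a -> K a})
    (n : A -> nat) (GG : forall a, algebraic_group (iota a) (n a)) :
    topGroupType :=
  product_group (fun a => rational_point (GG a)).

(* Main.v *)
Require Import Defs.
From HB Require Import structures.
From mathcomp Require Import all_boot all_order all_algebra finmap.
From mathcomp Require Import all_classical all_reals all_analysis.

Set Implicit Arguments.
Unset Strict Implicit.
Unset Printing Implicit Defensive.

Import Order.TTheory GRing.Theory Num.Theory.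

Local Open Scope classical_set_scope.

(** Why the theorem holds. Let Lambda^2 denote the product set Lambda Lambda.
    For X in the hull and x in X put

      psi(X, x) = T(x^-1 s(X)) phi(X),

    which makes sense because X^-1 X is contained in Lambda^2. As T is a
    homomorphism, psi(X, x) = T(x^-1 y) psi(X, y) for x and y in X, and the
    cohomology equation says exactly that
    psi(gX, gx) = psi(X, x) beta(g, X)^-1 for almost every X. So if W is an
    open neighbourhood of the identity in H and Z = W h L, the marked points
    X' = {x in X : psi(X, x) in Z} form a random subset of G with
    (gX)' = gX' almost surely: its law is stationary ([stationary_hits]). Two
    marked points x, y satisfy
    T(x^-1 y) in Z Z^-1 = W h L h^-1 W^-1. Hence
    Lambda' = {l in Lambda^2 : T l in V h L h^-1 V^-1} contains every return
    set X'^-1 X' once W lies in V. For h in the support of the law of phi, X'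
    is nonempty with positive probability, whatever W is.

    It remains to see that the return sets are large: finitely many right
    translates of Lambda' cover Lambda ([return_set_covers]). This is a
    pigeonhole argument. Let U be a small neighbourhood of the identity. For
    f and g in Lambda, if X' f and X' g both meet U, then they meet it in the
    same point, because Lambda^4 is discrete; so f g^-1 is in X'^-1 X'. If
    f g^-1 is not in Lambda', the events that X' f meets U and that X' g meets
    U are therefore disjoint. A family of elements f that are separated in this
    way is bounded in size as soon as these events have a probability bounded
    below, and a maximal family gives the covering.

    The intensity m(S), the probability that X' meets S, is invariant under
    left translations of S, and the point is to bound m(U f) below for f in
    Lambda. A right translation could multiply a Haar measure by an arbitrary
    constant, but a stationary set cannot have points in U f for too small a
    proportion of the time without having too many in U f^-1, where there is
    at most one. Precisely, counting the pairs formed by a point of X' and a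
    point of an independent copy of X' gives
    m(A) m(B) <= m(A B) m(B^-1) when A B contains at most one point of X'
    ([displacement_inequality]), and this inequality for B = V f^-1 and for
    B^-1 yields m(U f) >= m(A)^2 when A A is contained in U
    ([intensity_rtrans_ge]).

    Measurability rests on countable bases of the topologies of G and H. For G
    one is found from a compact neighbourhood V of 0 in a local field k and an
    element a with powers tending to 0: the sets a^n V are a base at 0, and
    k is the union of the compact sets a^-n V ([local_field_countable_base]). *)

(** * Countable bases and separation *)

(** A second countability indexed by the integers, so that unions over basic
    open sets are countable unions as they occur in a sigma-algebra. *)
Definition countable_base (T : topologicalType) (b : nat -> set T) : Prop :=
  (forall i, open (b i)) /\
  forall x S, nbhs x S -> exists i, b i x /\ b i `<=` S.

Lemma second_countable_base (T : topologicalType) :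
  @second_countable T -> exists b : nat -> set T, countable_base b.
Proof.
move=> [B /countable_injP[f fB] [Bo Bn]].
pose b i := \bigcup_(U in [set U | B U /\ f U = i]) U.
have bE U : B U -> b (f U) = U.
  move=> BU; apply/seteqP; split=> [x [V [BV fV]]|x Ux]; last by exists U.
  by rewrite (fB V U _ _ fV) ?inE.
exists b; split=> [i|x S /Bn[U [BU Ux] US]]; last first.
  by exists (f U); rewrite bE.
by apply: bigcup_open => U [/Bo].
Qed.

(** Attach to each basic open set one point y, if any, such that U y contains
    it: these countably many points do for all the others. *)
Lemma lindelof (T : ptopologicalType) (b : nat -> set T) (U : T -> set T) :
  countable_base b -> (forall x, nbhs x (U x)) ->
  exists c : nat -> T, forall x, exists i, U (c i) x.
Proof.
move=> [_ bN] xU.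
exists (fun i => xget point [set y | b i `<=` U y]) => x.
have [i [bx bU]] := bN _ _ (xU x); exists i.
have : b i `<=` U (xget point [set y | b i `<=` U y]).
  exact: (@xgetPex _ point [set y | b i `<=` U y] (ex_intro _ x bU)).
exact.
Qed.

Lemma countable_base_reindex (T : topologicalType) (I : countType)
    (b : I -> set T) :
  (forall i, open (b i)) ->
  (forall x S, nbhs x S -> exists i, b i x /\ b i `<=` S) ->
  exists c : nat -> set T, countable_base c.
Proof.
move=> bo bN; exists (fun n => if @choice.unpickle I n is Some i then b i else set0).
split=> [n|x S /bN[i [bx bS]]].
  by case: choice.unpickle => [i|]; [exact: bo|exact: open0].
by exists (choice.pickle i); rewrite choice.pickleK.
Qed.

(** Matrices, rational points and finite products all carry the initial topology
    of finitely many maps to spaces with a countable base; the last hypothesis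
    says that neighbourhoods come from these maps. *)
Lemma finite_initial_countable_base (X : topologicalType) (I : finType)
    (Y : I -> topologicalType) (f : forall i, X -> Y i)
    (b : forall i, nat -> set (Y i)) :
  (forall i, countable_base (b i)) -> (forall i, continuous (f i)) ->
  (forall x S, nbhs x S -> exists O : forall i, set (Y i),
    (forall i, nbhs (f i x) (O i)) /\ forall y, (forall i, O i (f i y)) -> S y) ->
  exists c : nat -> set X, countable_base c.
Proof.
move=> hb fC fN.
apply: (@countable_base_reindex X {ffun I -> nat}
  (fun u => [set x | forall i, b i (u i) (f i x)])).
  move=> u; rewrite openE => x xu; apply: filter_forall => i.
  by apply: fC; apply: open_nbhs_nbhs; split; [exact: (hb i).1|exact: xu].
move=> x S /fN[B [xB BS]].
have /choice[u uP] : forall i, exists n, b i n (f i x) /\ b i n `<=` B i.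
  by move=> i; exact: (hb i).2.
exists [ffun i => u i]; split=> [i|y /= yu].
  by rewrite ffunE; have [] := uP i.
by apply: BS => i; have [_] := uP i; apply; have := yu i; rewrite ffunE.
Qed.

Lemma accessible_of_separating (X : topologicalType) (I : Type)
    (Y : I -> topologicalType) (f : forall i, X -> Y i) :
  (forall i, continuous (f i)) -> (forall i, accessible_space (Y i)) ->
  (forall x y, (forall i, f i x = f i y) -> x = y) -> accessible_space X.
Proof.
move=> fC T1 f_inj x y xy.
have [i fxy] : exists i, f i x != f i y.
  apply: contrapT => nfxy; move/eqP: xy; apply; apply: f_inj => i.
  by apply: contrapT => /eqP fxy; apply: nfxy; exists i.
have [B [oB xB yB]] := T1 i _ _ fxy.
exists (f i @^-1` B); split.
- by apply: open_comp oB => z _; exact: fC.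
- by move: xB; rewrite !inE.
- by move: yB; rewrite !inE.
Qed.

(** * Topological groups *)

Section TopologicalGroupFacts.
Variable G : topGroupType.
Implicit Types (A B S : set G) (g : G).
Local Open Scope group_scope.

Definition ltrans g S : set G := [set g * x | x in S].

Lemma ltransE g S : ltrans g S = (fun x => g^-1 * x) @^-1` S.
Proof.
apply/seteqP; split=> [_ [x Sx <-] | x Sx] /=; first by rewrite mulKg.
by exists (g^-1 * x); rewrite ?mulVKg.
Qed.

Lemma mulg_near (x y : G) S : nbhs (x * y) S ->
  exists U V, [/\ open U, U x, open V, V y & setmulg U V `<=` S].
Proof.
move=> xyS; have [[U V] /= [xU yV] UVS] := @mulg_continuous G (x, y) S xyS.
move: xU yV; rewrite !nbhsE => -[U' [oU' U'x] U'U] [V' [oV' V'y] V'V].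
exists U', V'; split=> // _ [u Uu [v Vv <-]].
by apply: (UVS (u, v)); split; [exact: U'U|exact: V'V].
Qed.

Lemma mulgl_continuous g : continuous (fun x : G => g * x).
Proof.
move=> x S /mulg_near[U [V [_ Ug oV Vx UVS]]].
apply: (filterS _ (open_nbhs_nbhs (conj oV Vx))) => y Vy.
by apply: UVS; exists g => //; exists y.
Qed.

Lemma mulgr_continuous g : continuous (fun x : G => x * g).
Proof.
move=> x S /mulg_near[U [V [oU Ux _ Vg UVS]]].
apply: (filterS _ (open_nbhs_nbhs (conj oU Ux))) => y Uy.
by apply: UVS; exists y => //; exists g.
Qed.

Lemma open_ltrans g S : open S -> open (ltrans g S).
Proof. by rewrite ltransE; apply: open_comp => x _; exact: mulgl_continuous. Qed.

Lemma open_setmulgl A B : open A -> open (setmulg A B).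
Proof.
move=> oA; have -> : setmulg A B = \bigcup_(y in B) ((fun x => x * y^-1) @^-1` A).
  apply/seteqP; split=> [_ [x Ax [y By <-]]|x [y By /= Axy]].
    by exists y => //=; rewrite mulgK.
  by exists (x * y^-1) => //; exists y; rewrite ?mulgVK.
by apply: bigcup_open => y _; apply: open_comp oA => x _; exact: mulgr_continuous.
Qed.

Lemma setinvgE A : setinvg A = (fun x => x^-1) @^-1` A.
Proof.
apply/seteqP; split=> [_ [x Ax <-]|x Ax] /=; first by rewrite invgK.
by exists x^-1; rewrite ?invgK.
Qed.

Lemma open_setinvg A : open A -> open (setinvg A).
Proof. by rewrite setinvgE; apply: open_comp => x _; exact: invg_continuous. Qed.

Lemma setinvgK : involutive (@setinvg G).
Proof.
by move=> A; rewrite !setinvgE; apply/seteqP; split=> x /=; rewrite invgK.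
Qed.

End TopologicalGroupFacts.

(** * Borel sets and almost sure comparisons *)

Lemma borel_open (X : ptopologicalType) (U : set X) :
  open U -> measurable (U : set (borel X)).
Proof. exact: sub_sigma_algebra. Qed.

Lemma borel_closed (X : ptopologicalType) (U : set X) :
  closed U -> measurable (U : set (borel X)).
Proof.
move=> cU; rewrite -[U : set (borel X)]setCK; apply: measurableC.
by apply: borel_open; rewrite openC.
Qed.

Lemma borel_continuous (X Y : ptopologicalType) (f : X -> Y) :
  continuous f -> measurable_fun setT (f : borel X -> borel Y).
Proof.
move=> fC; apply: (@measurability _ _ (borel X) (borel Y) setT f (@open Y)) => //.
move=> _ [U oU <-]; rewrite setTI; apply: borel_open.
by move/continuousP : fC; exact.
Qed.

Section Measures.
Variables (R : realType) (d : measure_display) (X : measurableType d).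
Variable mu : probability X R.
Local Open Scope ereal_scope.

Lemma measure_ae_le (A B : set X) : measurable A -> measurable B ->
  (\forall x \ae mu, A x -> B x) -> mu A <= mu B.
Proof.
move=> mA mB [N [mN N0 ABN]].
rewrite -[leRHS]adde0 -N0.
apply: (@le_trans _ _ (mu (B `|` N))); last exact: measureU2.
rewrite le_measure ?inE//; first exact: measurableU.
move=> x Ax; have [Bx|nBx] := pselect (B x); first by left.
by right; apply: ABN => /= AB; exact: nBx (AB Ax).
Qed.

Lemma measure_ae_eq (A B : set X) : measurable A -> measurable B ->
  (\forall x \ae mu, A x <-> B x) -> mu A = mu B.
Proof.
move=> mA mB AB; apply/eqP; rewrite eq_le; apply/andP.
by split; apply: measure_ae_le => //; apply: filterS AB => x [].
Qed.

(** If every y had a neighbourhood with a null preimage, countably many of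
    these neighbourhoods would cover Y and D would be null. The point y does
    not depend on W, which is what makes h independent of V in the theorem. *)
Lemma exists_support_point (Y : topGroupType) (b : nat -> set Y) (D : set X)
    (f : X -> borel Y) :
  countable_base b -> measurable D -> measurable_fun D f -> mu D != 0 ->
  exists y : Y, forall W : set Y, open W -> W 1%g ->
    0 < mu (D `&` f @^-1` setmulg W [set y]).
Proof.
move=> hb mD mf; apply: contra_neqP => /forallNP nh.
have oWy (W : set Y) (y : Y) : open W -> open (setmulg W [set y]).
  exact: open_setmulgl.
have /choice[W HW] : forall y : Y, exists W : set Y, [/\ open W, W 1%g &
    mu (D `&` f @^-1` setmulg W [set y]) = 0].
  move=> y; have /existsNP[W /not_implyP[oW /not_implyP[W1 nW]]] := nh y.
  by exists W; split=> //; apply/eqP; rewrite -measure_le0 leNgt; exact/negP.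
have [c cY] := lindelof hb (U := fun y => setmulg (W y) [set y]) (fun y : Y =>
  let: And3 oW W1 _ := HW y in open_nbhs_nbhs (conj (oWy _ y oW)
     (ex_intro2 _ _ 1%g W1 (ex_intro2 _ _ y erefl (mul1g y))))).
apply/negligibleP => //.
apply: (@negligibleS _ _ _ _ (\bigcup_i (D `&` f @^-1` setmulg (W (c i)) [set c i]))).
  by move=> x Dx; have [i xi] := cY (f x); exists i.
apply: negligible_bigcup => i; have [oW W1 W0] := HW (c i).
apply/negligibleP => //; apply: mf => //; apply: borel_open; exact: oWy.
Qed.

End Measures.

(** * Stationary random subsets of a group *)

Section StationaryRandomSet.
Local Open Scope ereal_scope.
Variables (R : realType) (d : measure_display) (Om : measurableType d).
Variables (nu : probability Om R) (G : topGroupType) (b : nat -> set G).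
Hypothesis hb : countable_base b.
Variable P : Om -> set G.

Definition hits (S : set G) : set Om := [set w | P w `&` S !=set0].

(** On such sets the probability of being hit is the expected number of
    points. *)
Definition thin (S : set G) : Prop :=
  forall w x y, P w x -> P w y -> S x -> S y -> x = y.

Hypothesis measurable_hits : forall S, open S -> measurable (hits S).
Hypothesis stationary :
  forall g S, open S -> nu (hits (ltrans g S)) = nu (hits S).

(** Under the product measure, the two components of a pair give independent
    copies of the random set. *)
Definition displaced_pairs (A B : set G) : set (Om * Om) :=
  [set ww | exists x y, [/\ P ww.1 x, A x, P ww.2 y & B (x^-1 * y)%g]].

(** The condition on (x, y) is open, so it is a countable union of conditions
    on x and y separately, taken from the countable base. *)
Lemma measurable_displaced_pairs A B : open A -> open B ->
  measurable (displaced_pairs A B).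
Proof.
move=> oA oB; have [bo bN] := hb.
pose good i j := b i `<=` A /\ forall x y, b i x -> b j y -> B (x^-1 * y)%g.
have -> : displaced_pairs A B =
    \bigcup_i \bigcup_(j in good i) (hits (b i) `*` hits (b j)).
  apply/seteqP; split=> [[w1 w2] /= [x [y [Px Ax Py Bxy]]]|].
    have /mulg_near[U [V [oU Ux oV Vy UVB]]] : nbhs (x^-1 * y)%g B.
      exact: open_nbhs_nbhs.
    have xU : nbhs x (setinvg U).
      apply: open_nbhs_nbhs; split; first exact: open_setinvg.
      by rewrite setinvgE.
    have [i [bix biAU]] := bN x _ (filterI (open_nbhs_nbhs (conj oA Ax)) xU).
    have [j [bjy bjV]] := bN y _ (open_nbhs_nbhs (conj oV Vy)).
    exists i => //; exists j; last by split; [exists x|exists y].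
    split=> [z /biAU[]//|x' y' /biAU[_]]; rewrite setinvgE => Ux' /bjV Vy'.
    by apply: UVB; exists (x'^-1)%g => //; exists y'.
  move=> [w1 w2] [i _ [j [biA ijB]]] /= [[x [Px bix]] [y [Py bjy]]].
  by exists x, y; split=> //; [exact: biA|exact: ijB].
apply: bigcup_measurable => i _; apply: bigcup_measurable => j _.
by apply: measurableX; exact: measurable_hits.
Qed.

(** Both sides estimate the measure of [displaced_pairs A B]. Given a point x of
    the first set in A, the second set meets x B with probability
    nu (hits B), by stationarity. Given the second set, its displaced point y
    lies in A B, where it is unique by thinness, and the first set has to meet
    y B^-1, which happens with probability nu (hits B^-1). *)
Lemma displacement_inequality A B : open A -> open B -> thin (setmulg A B) ->
  nu (hits A) * nu (hits B) <= nu (hits (setmulg A B)) * nu (hits (setinvg B)).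
Proof.
move=> oA oB tAB.
set Q := displaced_pairs A B.
have mQ : measurable Q by exact: measurable_displaced_pairs.
have := @indic_fubini_tonelli _ _ Om Om R nu nu Q mQ.
rewrite indic_fubini_tonelli_FE// indic_fubini_tonelli_GE// => E.
have mAB := measurable_hits (open_setmulgl B oA).
have mA := measurable_hits oA.
have lower : nu (hits A) * nu (hits B) <= \int[nu]_x (nu \o xsection Q) x.
  apply: (@le_trans _ _ (\int[nu]_(x in hits A) (nu \o xsection Q) x)); last first.
    by apply: ge0_subset_integral => //; exact: measurable_fun_xsection.
  rewrite muleC -integral_cst//; apply: ge0_le_integral => //.
    by apply: (measurable_funS measurableT) => //; exact: measurable_fun_xsection.
  move=> w [x [Px Ax]] /=.
  rewrite -(stationary x oB) le_measure ?inE//.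
  - by apply: measurable_hits; exact: open_ltrans.
  - exact: measurable_xsection.
  - move=> w' [y [Py]]; rewrite ltransE => /= Bxy.
    by rewrite /xsection /= inE; exists x, y.
have upper : \int[nu]_y (nu \o ysection Q) y <=
    nu (hits (setmulg A B)) * nu (hits (setinvg B)).
  have hitsQ w : (nu \o ysection Q) w != 0 -> hits (setmulg A B) w.
    apply: contra_neqP => nhit /=.
    have -> : ysection Q w = set0; last by rewrite measure0.
    rewrite -subset0 => w'; rewrite /ysection /= inE => -[x [y /= [Px Ax Py Bxy]]].
    apply: nhit; exists y; split=> //; exists x => //; exists (x^-1 * y)%g => //.
    by rewrite mulVKg.
  have -> : \int[nu]_y (nu \o ysection Q) y =
      \int[nu]_(y in hits (setmulg A B)) (nu \o ysection Q) y.
    rewrite [RHS]integral_mkcond; apply: eq_integral => w _.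
    rewrite patchE; case: ifPn => // wAB; apply/eqP; apply: contraNT wAB => /hitsQ.
    by rewrite inE.
  rewrite muleC -integral_cst//; apply: ge0_le_integral => //.
    by apply: (measurable_funS measurableT) => //; exact: measurable_fun_ysection.
  move=> w [y [Py ABy]] /=.
  have oB' := open_setinvg oB.
  rewrite -(stationary y oB') le_measure ?inE//.
  - exact: measurable_ysection.
  - by apply: measurable_hits; exact: open_ltrans.
  move=> w'; rewrite /ysection /= inE => -[x [y' /= [Px Ax Py' Bxy]]].
  have ABy' : setmulg A B y'.
    by exists x => //; exists (x^-1 * y')%g => //; rewrite mulVKg.
  have yy' : y' = y by exact: (tAB w).
  exists x; split=> //; rewrite ltransE setinvgE /=.
  by rewrite invgM invgK -yy'.
by rewrite (le_trans lower)// E.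
Qed.

Lemma hitsS A B : A `<=` B -> hits A `<=` hits B.
Proof. by move=> AB w [x [Px /AB Bx]]; exists x. Qed.

(** The left-invariant set function that takes the place of a Haar measure; it
    agrees with the expected number of points only on thin sets. *)
Definition intensity (S : set G) : R := fine (nu (hits S)).

Lemma intensityE S : open S -> nu (hits S) = (intensity S)%:E.
Proof. by move=> oS; rewrite fineK// fin_num_measure//; exact: measurable_hits. Qed.

Lemma intensity_ge0 S : (0 <= intensity S)%R.
Proof. by apply: fine_ge0; exact: measure_ge0. Qed.

Lemma intensity_le1 S : open S -> (intensity S <= 1)%R.
Proof.
move=> oS; rewrite -lee_fin -intensityE//; apply: probability_le1.
exact: measurable_hits.
Qed.

Lemma intensity_mono A B : open A -> open B -> A `<=` B ->
  (intensity A <= intensity B)%R.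
Proof.
move=> oA oB AB; rewrite -lee_fin -!intensityE// le_measure ?inE//;
  by [exact: measurable_hits|exact: hitsS].
Qed.

Lemma thinS A B : A `<=` B -> thin B -> thin A.
Proof. by move=> AB tB w x y Px Py /AB Bx /AB By; exact: (tB w). Qed.

Lemma intensity_displacement A B : open A -> open B -> thin (setmulg A B) ->
  (intensity A * intensity B <= intensity (setmulg A B) * intensity (setinvg B))%R.
Proof.
move=> oA oB tAB; rewrite -lee_fin !EFinM -!intensityE//.
- exact: displacement_inequality.
- exact: open_setinvg.
- exact: open_setmulgl.
Qed.

Hypothesis nonempty : 0 < nu (hits setT).

(** Countably many left translates of S cover the group, and all of them are
    hit with the same probability. *)
Lemma intensity_gt0 S : open S -> S !=set0 -> (0 < intensity S)%R.
Proof.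
move=> oS [s Ss]; rewrite lt0r intensity_ge0 andbT; apply/negP => /eqP S0.
have [c cG] : exists c : nat -> G,
    forall x, exists i, ltrans (c i * s^-1)%g S x.
  apply: (lindelof hb (U := fun y => ltrans (y * s^-1)%g S)) => x.
  apply: open_nbhs_nbhs; split; first exact: open_ltrans.
  by exists s => //; rewrite mulgVK.
have : nu.-negligible (hits setT).
  apply: (@negligibleS _ _ _ _ (\bigcup_i hits (ltrans (c i * s^-1)%g S))).
    by move=> w [x [Px _]]; have [i xi] := cG x; exists i => //; exists x.
  apply: negligible_bigcup => i; apply/negligibleP.
    by apply: measurable_hits; exact: open_ltrans.
  by apply: etrans (stationary _ oS) _; rewrite intensityE// S0.
move/negligibleP; rewrite (_ : nu _ = 0 <-> False); last first.
  by split=> // n0; move: nonempty; rewrite n0 ltxx.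
by apply; apply: measurable_hits; exact: openT.
Qed.

(** Apply the displacement inequality to (A, B) and to (A, B^-1), where
    B = V g^-1 with V a tiny neighbourhood of the identity:
      m(A) m(B) <= m(B^-1)  and  m(A) m(B^-1) <= m(U g) m(B).
    The unknown ratio m(B^-1) / m(B) cancels. What a modular function would
    measure is controlled by thinness: U g^-1 contains at most one point. *)
Lemma intensity_rtrans_ge (g : G) A U : open A -> open U -> A 1%g ->
  setmulg A A `<=` U -> thin (setmulg U [set g]) ->
  thin (setmulg U [set g^-1%g]) ->
  (intensity A ^+ 2 <= intensity (setmulg U [set g]))%R.
Proof.
move=> oA oU A1 AAU tUg tUg'.
(* V is small on both sides of g: A V g^-1 stays in U g^-1 because V is in A,
   and A g V^-1 = A (g V^-1 g^-1) g stays in U g because g V^-1 g^-1 is in A. *)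
pose V := A `&` [set v | A (g * v^-1 * g^-1)%g].
have oV : open V.
  apply: openI => //.
  apply: (@open_comp _ _ (fun v : G => (g * v^-1 * g^-1)%g)) oA => v _.
  apply: (@continuous_comp _ _ _ (fun v : G => (g * v^-1)%g)
    (fun v : G => (v * g^-1)%g)); last exact: mulgr_continuous.
  apply: (@continuous_comp _ _ _ (fun v : G => (v^-1)%g)
    (fun v : G => (g * v)%g)); last exact: mulgl_continuous.
  exact: invg_continuous.
have V1 : V 1%g by split=> //=; rewrite invg1 mulg1 mulgV.
pose B := setmulg V [set g^-1%g].
have oB : open B by exact: open_setmulgl.
have oB' := open_setinvg oB.
have ABU : setmulg A B `<=` setmulg U [set g^-1%g].
  move=> _ [a Aa [_ [v [Av _] [_ -> <-]] <-]].
  exists (a * v)%g; first by apply: AAU; exists a => //; exists v.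
  by exists g^-1%g => //; rewrite mulgA.
have ABU' : setmulg A (setinvg B) `<=` setmulg U [set g].
  move=> _ [a Aa [_ [_ [v [_ Av] [_ -> <-]] <-] <-]].
  exists (a * (g * v^-1 * g^-1))%g.
    by apply: AAU; exists a => //; exists (g * v^-1 * g^-1)%g.
  by exists g => //; rewrite invgM invgK -!mulgA mulVg mulg1.
have B0 : (0 < intensity B)%R.
  by apply: intensity_gt0 => //; exists (1 * g^-1)%g; exists 1%g => //; exists g^-1%g.
have h1 := intensity_displacement oA oB (thinS ABU tUg').
have h2 := intensity_displacement oA oB' (thinS ABU' tUg).
rewrite setinvgK in h2.
have oUg : open (setmulg U [set g]) by exact: open_setmulgl.
have h3 : (intensity (setmulg A (setinvg B)) <= intensity (setmulg U [set g]))%R.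
  by apply: intensity_mono => //; exact: open_setmulgl.
rewrite -(ler_pM2r B0); apply: le_trans (ler_wpM2r (ltW B0) h3); apply: le_trans h2.
rewrite expr2 -mulrA ler_wpM2l ?intensity_ge0//.
apply: (le_trans h1); rewrite ler_piMl ?intensity_ge0//.
by apply: intensity_le1; exact: open_setmulgl.
Qed.

(** Pigeonhole. The sets [P w] f, for f in [Lam], meet U in one and the same
    point or not at all. So f and g in [Lam] with f g^-1 outside [Lam'] give
    disjoint events of probability at least m(A)^2; a family of elements
    separated in this way has at most 1 / m(A)^2 members, and a maximal one is
    the required set F. *)
Lemma return_set_covers (Lam Lam' A U : set G) :
  (forall f, Lam f -> Lam (f^-1)%g) ->
  open A -> open U -> A 1%g -> setmulg A A `<=` U ->
  (forall w x y f g, P w x -> P w y -> Lam f -> Lam g ->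
     U (x * f)%g -> U (y * g)%g -> (x * f = y * g)%g) ->
  (forall w x y, P w x -> P w y -> Lam' (x^-1 * y)%g) ->
  exists F, finite_set F /\ Lam `<=` setmulg Lam' F.
Proof.
move=> LamV oA oU A1 AAU Uone PLam'; apply: contrapT => nF.
have thinU f : Lam f -> thin (setmulg U [set f^-1%g]).
  move=> Lf w x y Px Py [u Uu [_ -> ux]] [v Uv [_ -> vy]].
  rewrite -ux in Px *; rewrite -vy in Py *.
  by apply: (mulIg f); apply: (Uone w) => //; rewrite mulgVK.
pose D f := hits (setmulg U [set f^-1%g]).
have mD f : measurable (D f) by apply: measurable_hits; exact: open_setmulgl.
have cD f : Lam f -> ((intensity A ^+ 2)%:E <= nu (D f)).
  move=> Lf; rewrite intensityE; last exact: open_setmulgl.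
  rewrite lee_fin intensity_rtrans_ge//; first exact: thinU.
  by apply: thinU; exact: LamV.
have Ddisj f g : Lam f -> Lam g -> ~ Lam' (f * g^-1)%g -> D f `&` D g = set0.
  move=> Lf Lg nfg; rewrite -subset0 => w [[x [Px [u Uu [_ -> ux]]]]].
  move=> [y [Py [v Uv [_ -> vy]]]]; apply: nfg.
  rewrite -ux in Px; rewrite -vy in Py.
  have uv : u = v.
    by have := Uone w _ _ f g Px Py Lf Lg; rewrite !mulgVK; exact.
  by have := PLam' w _ _ Px Py; rewrite uv invgM invgK mulgA mulgVK.
(* If no finite set covered, such families could be extended for ever. *)
have sep n : exists fs : seq G, [/\ size fs = n, (forall f, f \in fs -> Lam f) &
    ((n%:R * intensity A ^+ 2)%:E <= nu (\big[setU/set0]_(f <- fs) D f))].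
  elim: n => [|n [fs [sfs Lfs IH]]].
    by exists [::]; split=> //; rewrite mul0r measure_ge0.
  have [f Lf nf] : exists2 f, Lam f & forall g, g \in fs -> ~ Lam' (f * g^-1)%g.
    apply: contrapT => nf; apply: nF; exists [set` fs].
    split=> [|f Lf]; first exact: finite_seq.
    apply: contrapT => ff; apply: nf; exists f => // g gfs Lfg; apply: ff.
    by exists (f * g^-1)%g => //; exists g => //; rewrite mulgVK.
  exists (f :: fs); split=> /= [|g|]; first by rewrite sfs.
    by rewrite inE => /predU1P[->//|/Lfs].
  rewrite big_cons measureU//; last 2 first.
  - by apply: bigsetU_measurable.
  - rewrite big_distrr/= big1_seq// => g /andP[_ gfs].
    by apply: Ddisj => //; [exact: Lfs|exact: nf].
  by rewrite -natr1 mulrDl mul1r addrC EFinD leeD// cD.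
have c0 : (0 < intensity A ^+ 2)%R.
  by rewrite exprn_gt0// intensity_gt0//; exists 1%g.
have [n nc] : exists n, (1 < n%:R * intensity A ^+ 2)%R.
  exists (Num.truncn (intensity A ^+ 2)^-1).+1; rewrite -ltr_pdivrMr// div1r.
  by rewrite truncnS_gt.
have [fs [_ _ le1]] := sep n.
have : (n%:R * intensity A ^+ 2 <= 1)%R.
  rewrite -lee_fin; apply: (le_trans le1); apply: probability_le1.
  exact: bigsetU_measurable.
by rewrite leNgt nc.
Qed.

End StationaryRandomSet.

(** * The space of closed subsets and the invariant hull *)

Section ChabautyFellFacts.
Variable G : topologicalType.

Lemma chabauty_fell_subbase_open (O : set (closedSpace G)) :
  chabauty_fell_subbase O -> open O.
Proof.
move=> hO; exists [set O]; last by rewrite bigcup_set1.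
by move=> _ ->; exact: (@finI_from1 _ _ (@chabauty_fell_subbase G) id O hO).
Qed.

Lemma open_meets (V : set G) : open V ->
  open [set C : closedSpace G | sval C `&` V !=set0].
Proof. by move=> oV; apply: chabauty_fell_subbase_open; right; exists V. Qed.

Lemma chabauty_fell_continuous (X : topologicalType) (f : X -> closedSpace G) :
  (forall O, chabauty_fell_subbase O -> open (f @^-1` O)) -> continuous f.
Proof.
move=> fO; apply/continuousP => _ [D' sD' <-].
rewrite preimage_bigcup; apply: bigcup_open => _ /sD'[D DS <-].
rewrite preimage_bigcap /= openE => x xD.
apply: filter_bigI => O OD; apply: open_nbhs_nbhs; split; last exact: xD.
by apply: fO; have := DS _ OD; rewrite inE.
Qed.

End ChabautyFellFacts.

(** Translating a closed set by g amounts to translating the test sets of the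
    subbase by g^-1, which preserves compactness and openness. *)
Lemma translate_continuous (G : topGroupType) (g : G) :
  continuous (translate g).
Proof.
apply: chabauty_fell_continuous => O [[K cK <-]|[V oV <-]].
  have -> : translate g @^-1` [set C | sval C `&` K = set0] =
      [set C | sval C `&` ltrans g^-1%g K = set0].
    apply/seteqP; split=> C /=; rewrite -!subset0 => CK x [].
      move=> Cx [k Kk gkx]; apply: (CK k); split=> //.
      by exists x; rewrite // -gkx mulVKg.
    move=> [y Cy <-] Kgy; apply: (CK y); split=> //.
    by exists (g * y)%g; rewrite ?mulKg.
  apply: chabauty_fell_subbase_open; left; exists (ltrans g^-1%g K) => //.
  apply: continuous_compact cK; apply: continuous_subspaceT => x.
  exact: mulgl_continuous.
have -> : translate g @^-1` [set C | sval C `&` V !=set0] =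
    [set C | sval C `&` ltrans g^-1%g V !=set0].
  apply/seteqP; split=> C /=.
    move=> [_ [[x Cx <-] Vgx]]; exists x; split=> //.
    by exists (g * x)%g; rewrite ?mulKg.
  move=> [y [Cy [v Vv vy]]]; exists v; split=> //; rewrite -vy in Cy.
  by exists (g^-1 * v)%g; rewrite ?mulVKg.
by apply: open_meets; exact: open_ltrans.
Qed.

(** If C contains x and y with x^-1 y outside the closed set of allowed
    differences, so does every closed set that meets small neighbourhoods of x
    and of y. *)
Lemma closed_extended_hull (G : topGroupType) (X : set G) :
  closed (extended_hull X).
Proof.
rewrite -openC openE => C nC.
have [_ [[_ [x Cx <-] [y Cy <-]] nxy]] : exists z,
    setmulg (setinvg (sval C)) (sval C) z /\ ~ closure (setmulg (setinvg X) X) z.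
  apply: contrapT => nz; apply: nC => z Cz.
  by apply: contrapT => ncz; apply: nz; exists z.
have /mulg_near[U [V [oU Ux oV Vy UV]]] :
    nbhs (x^-1 * y)%g (~` closure (setmulg (setinvg X) X)).
  by apply: open_nbhs_nbhs; split=> //; rewrite openC; exact: closed_closure.
have oU' := open_setinvg oU.
apply: (@filterS _ _ _ ([set C | sval C `&` setinvg U !=set0] `&`
    [set C | sval C `&` V !=set0])); last first.
  apply: filterI; apply: open_nbhs_nbhs; split; try exact: open_meets.
    by exists x; split=> //; rewrite setinvgE.
  by exists y.
move=> D [[u [Du Uu]] [v [Dv Vv]]] /= DX.
apply: (UV (u^-1 * v)%g).
  by exists (u^-1)%g; [rewrite setinvgE in Uu|exists v].
by apply: DX; exists (u^-1)%g; [exists u|exists v].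
Qed.

Lemma extended_hull_translate (G : topGroupType) (X : set G) g C :
  extended_hull X C -> extended_hull X (translate g C).
Proof.
move=> XC _ [_ [_ [x Cx <-] <-] [_ [y Cy <-] <-]]; apply: XC.
exists (x^-1)%g; first by exists x.
by exists y => //; rewrite invgM -!mulgA mulKg.
Qed.

(** * Local finiteness of approximate subgroups *)

Section ApproximateSubgroups.
Variable G : topGroupType.
Hypothesis T1 : accessible_space G.
Implicit Types (Lam E F : set G).
Local Open Scope group_scope.

(** Two points f l and f l' of x S satisfy l^-1 l' in S^-1 S. For S small,
    uniform discreteness makes them equal, so x S contains at most one point of
    f Lam; if it is not x, it can be removed from the neighbourhood. *)
Lemma near_translate_isolated Lam (f x : G) : uniformly_discrete Lam ->
  nbhs x [set y | ltrans f Lam y -> y = x].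
Proof.
move=> [_ [V V1 VL]].
have /mulg_near[U [W [oU U1 oW W1 UWV]]] : nbhs (1^-1 * 1 : G) V.
  by rewrite invg1 mulg1.
pose S := setinvg U `&` W.
have S1 : S 1 by split=> //; rewrite setinvgE /= invg1 -[1]invg1.
have oS : open S by apply: openI => //; exact: open_setinvg.
have oxS : open (ltrans x S) by exact: open_ltrans.
have xxS : ltrans x S x by exists 1 => //; rewrite mulg1.
have uniq y z : ltrans x S y -> ltrans x S z -> ltrans f Lam y ->
    ltrans f Lam z -> y = z.
  move=> [u [Uu Wu] <-] [v [Uv Wv] <-] [l Ll fl] [l' Ll' fl'].
  have uv : u^-1 * v = l^-1 * l'.
    have -> : u = x^-1 * (f * l) by rewrite fl mulKg.
    have -> : v = x^-1 * (f * l') by rewrite fl' mulKg.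
    by rewrite !invgM !invgK !mulgA mulgK mulgVK.
  have : (V `&` setmulg (setinvg Lam) Lam) (u^-1 * v).
    split; last by rewrite uv; exists l^-1; [exists l|exists l'].
    by apply: UWV; exists u^-1; [rewrite setinvgE in Uu|exists v].
  by rewrite VL => /= uv1; rewrite -[u]mulg1 -uv1 mulVKg.
have [[y [ySx Ly yx]]|nex] :=
    pselect (exists y, [/\ ltrans x S y, ltrans f Lam y & y <> x]).
  have oy : open (~` [set y]).
    by rewrite openC; exact: (accessible_closed_set1 T1).
  have : nbhs x (ltrans x S `&` ~` [set y]).
    apply: open_nbhs_nbhs; split; first exact: openI.
    by split=> // /esym.
  by apply: filterS => z [zS zy] Lz; case: zy; exact: uniq.
apply: filterS (open_nbhs_nbhs (conj oxS xxS)) => z zS Lz.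
by apply: contrapT => zx; apply: nex; exists z.
Qed.

Lemma near_finite_translates_isolated Lam F E (x : G) :
  uniformly_discrete Lam -> finite_set F -> E `<=` setmulg F Lam ->
  nbhs x [set y | E y -> y = x].
Proof.
move=> dL /finite_fsetP[D ->] EDL.
have : nbhs x (\bigcap_(f in [set` D]) [set y | ltrans f Lam y -> y = x]).
  by apply: filter_bigI => f _; exact: near_translate_isolated.
apply: filterS => y Dy Ey; have [f Df [l Ll fl]] := EDL _ Ey.
by apply: (Dy f Df); exists l.
Qed.

Lemma locally_isolated_closed E :
  (forall x : G, nbhs x [set y | E y -> y = x]) -> closed E.
Proof. by move=> nE x /(_ _ (nE x)) [y [Ey /(_ Ey) <-]]. Qed.

Lemma locally_isolated_countable (b : nat -> set G) E : countable_base b ->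
  (forall x : G, nbhs x [set y | E y -> y = x]) -> countable E.
Proof.
move=> [_ bN] nE.
have /choice[c cP] : forall x : G, exists i, b i x /\ b i `<=` [set y | E y -> y = x].
  by move=> x; exact: bN.
apply/countable_injP; exists c => x y; rewrite !inE => Ex Ey cxy.
by have [_ /(_ x)] := cP y; rewrite -cxy; apply => //; have [] := cP x.
Qed.

Definition setsqr (A : set G) : set G := setmulg A A.

Lemma setmulgA (A B C : set G) : setmulg (setmulg A B) C = setmulg A (setmulg B C).
Proof.
apply/seteqP; split.
  move=> _ [_ [a Aa [x Bx <-]] [c Cc <-]]; exists a => //.
  by exists (x * c); [exists x => //; exists c|rewrite mulgA].
move=> _ [a Aa [_ [x Bx [c Cc <-]] <-]].
exists (a * x); first by exists a => //; exists x.
by exists c => //; rewrite mulgA.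
Qed.

Lemma setmulgS (A B C D : set G) :
  A `<=` B -> C `<=` D -> setmulg A C `<=` setmulg B D.
Proof. by move=> AB CD _ [a /AB Ba [c /CD Dc <-]]; exists a => //; exists c. Qed.

Lemma finite_setmulg (A B : set G) :
  finite_set A -> finite_set B -> finite_set (setmulg A B).
Proof. by move=> fA fB; exact: finite_image2. Qed.

(** By iteration, all the powers of an approximate subgroup lie in finitely many
    translates of it and so are locally finite when it is uniformly discrete. *)
Lemma mul_approximate_subgroup E Lam : approximate_subgroup Lam ->
  (exists F, finite_set F /\ E `<=` setmulg F Lam) ->
  exists F, finite_set F /\ setmulg E Lam `<=` setmulg F Lam.
Proof.
move=> [_ _ [F [fF LF]]] [F' [fF' EF]].
exists (setmulg F' F); split; first exact: finite_setmulg.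
apply: (subset_trans (setmulgS EF (@subset_refl _ Lam))).
by rewrite !setmulgA; exact: setmulgS.
Qed.

End ApproximateSubgroups.

Section ApproximateSubgroupProducts.
Variables (G : topGroupType) (Lam : set G).
Hypothesis hLam : approximate_subgroup Lam.
Local Open Scope group_scope.

Lemma approxV x : Lam x -> Lam x^-1.
Proof. by case: hLam => _ LV _ Lx; rewrite -LV; exists x. Qed.

Lemma setsqrV x : setsqr Lam x -> setsqr Lam x^-1.
Proof.
move=> [a La [c Lc <-]]; exists c^-1; first exact: approxV.
by exists a^-1; [exact: approxV|rewrite invgM].
Qed.

Lemma generated_setsqr x : setsqr Lam x -> generated Lam x.
Proof.
by move=> [a La [c Lc <-]] S [[S1 SM _] LS]; apply: SM; exact: LS.
Qed.

Lemma generated_hom1 (H : groupType) (T : G -> H) :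
  hom_on_generated Lam T -> T 1 = 1.
Proof.
move=> hT; have g1 : generated Lam 1 by move=> S [[]].
by apply: (mulgI (T 1)); rewrite -hT// !mulg1.
Qed.

Lemma covered_setsqr : exists F, finite_set F /\ setsqr Lam `<=` setmulg F Lam.
Proof. by case: hLam. Qed.

Lemma covered_setsqr2 :
  exists F, finite_set F /\ setsqr (setsqr Lam) `<=` setmulg F Lam.
Proof.
rewrite {1}/setsqr -setmulgA; do 2 apply: mul_approximate_subgroup => //.
exact: covered_setsqr.
Qed.

(** Both sets are stable under inversion, so the one-sided coverings imply the
    two-sided ones. *)
Lemma commensurable_of_cover (Lam' : set G) : Lam' `<=` setsqr Lam ->
  (forall x, Lam' x -> Lam' x^-1) ->
  (exists F, finite_set F /\ Lam `<=` setmulg Lam' F) ->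
  commensurable Lam' Lam.
Proof.
move=> sL' L'V [F [fF LF]]; have [F' [fF' L2F']] := covered_setsqr.
have finV (E : set G) : finite_set E -> finite_set (setinvg E).
  exact: finite_image.
exists ((F `|` setinvg F) `|` (F' `|` setinvg F')); split.
- by rewrite !finite_setU; split; split=> //; exact: finV.
- move=> x L'x; split.
    have [f Ff [l Ll <-]] := L2F' _ (sL' _ L'x).
    by exists f; [right; left|exists l].
  have [f Ff [l Ll fl]] := L2F' _ (sL' _ (L'V _ L'x)).
  exists l^-1; first exact: approxV.
  by exists f^-1; [right; right; exists f|rewrite -invgM fl invgK].
- move=> x Lx; split; last first.
    by have [l Ll [f Ff <-]] := LF _ Lx; exists l => //; exists f => //; left; left.
  have [l Ll [f Ff lf]] := LF _ (approxV Lx).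
  exists f^-1; first by left; right; exists f.
  by exists l^-1; [exact: L'V|rewrite -invgM lf invgK].
Qed.

(** The fourth power appears because x f and y g, for x, y in a set of the
    hull and f, g in Lam, are such that (x f)^-1 (y g) is in Lam Lam^2 Lam. *)
Definition separating (U : set G) : Prop :=
  forall u v, U u -> U v -> setsqr (setsqr Lam) (u^-1 * v) -> u = v.

Lemma separating_ltrans x U : separating U -> separating (ltrans x U).
Proof.
move=> sU _ _ [u Uu <-] [v Vv <-]; rewrite invgM -mulgA mulKg => uv.
by congr (_ * _); exact: sU.
Qed.

Lemma separatingS U V : U `<=` V -> separating V -> separating U.
Proof. by move=> UV sV u v /UV Vu /UV; exact: sV. Qed.

Hypothesis T1 : accessible_space G.
Hypothesis dLam : uniformly_discrete Lam.

Lemma exists_separating : exists U, [/\ open U, U 1 & separating U].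
Proof.
have [F [fF L4F]] := covered_setsqr2.
have /(near_finite_translates_isolated T1 1 dLam fF) n1 := L4F.
have /mulg_near[U [V [oU U1 oV V1 UV]]] :
    nbhs (1^-1 * 1) [set y | setsqr (setsqr Lam) y -> y = 1].
  by rewrite invg1 mulg1.
exists (setinvg U `&` V); split.
- by apply: openI => //; exact: open_setinvg.
- by split=> //; rewrite setinvgE.
- move=> u v [Uu _] [_ Vv] uv4.
  have uv1 : u^-1 * v = 1.
    apply: (UV _ _ uv4); exists u^-1; first by rewrite setinvgE in Uu.
    by exists v.
  by rewrite -[u]mulg1 -uv1 mulVKg.
Qed.

Lemma closed_setsqr : closed (setsqr Lam).
Proof.
have [F [fF L2F]] := covered_setsqr; apply: locally_isolated_closed => x.
exact: near_finite_translates_isolated dLam fF L2F.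
Qed.

Lemma countable_setsqr (b : nat -> set G) : countable_base b -> countable (setsqr Lam).
Proof.
have [F [fF L2F]] := covered_setsqr.
move=> hb; apply: (locally_isolated_countable hb) => x.
exact: near_finite_translates_isolated dLam fF L2F.
Qed.

(** The square of Lam is locally finite, hence equal to the closure occurring in
    the definition of the hull. *)
Lemma hull_differences C x y :
  extended_hull Lam C -> sval C x -> sval C y -> setsqr Lam (x^-1 * y).
Proof.
move=> /(_ (x^-1 * y)); rewrite (let: And3 _ LV _ := hLam in LV) => LC Cx Cy.
have /closure_id -> := closed_setsqr.
by apply: LC; exists x^-1; [exists x|exists y].
Qed.

End ApproximateSubgroupProducts.

(** * The marked points of a random closed set *)

Section CocycleReduction.
Local Open Scope ereal_scope.
Variables (R : realType) (G H : topGroupType).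
Variables (b : nat -> set G) (c : nat -> set H).
Hypotheses (T1 : accessible_space G) (hb : countable_base b)
  (hc : countable_base c).
Variable Lam : set G.
Hypotheses (hLam : approximate_subgroup Lam) (dLam : uniformly_discrete Lam).
Variable nu : probability (borel (closedSpace G)) R.
Local Notation Om := (extended_hull Lam).
Hypotheses (nu_hull : nu Om = 1) (nu_proper : proper_measure nu)
  (nu_inv : invariant_measure nu).
Variable s : closedSpace G -> G.
Hypothesis hs : pointed_section Om s.
Variable T : G -> H.
Hypothesis hT : hom_on_generated Lam T.
Variable L : set H.
Hypothesis hL : is_subgroup L.
Variable beta : G -> closedSpace G -> H.
Hypothesis beta_L : values_in Om beta L.
Variable phi : closedSpace G -> H.
Hypothesis phi_meas :
  measurable_fun (Om : set (borel (closedSpace G))) (phi : _ -> borel H).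
Hypothesis phi_coh : forall g : G, \forall x \ae nu,
  T (section_cocycle s g x) = (phi (translate g x) * beta g x * (phi x)^-1)%g.

(** The value phi(C) belongs to the point s(C); the factor T (x^-1 s(C))
    transports it to the point x, so that the choice of s no longer matters. *)
Definition marked (Z : set H) (C : borel (closedSpace G)) : set G :=
  [set x | [/\ Om C, sval C x & Z (T (x^-1 * s C) * phi C)%g]].

Lemma T_difference C x y z : Om C -> sval C x -> sval C y -> sval C z ->
  (T (x^-1 * y) * T (y^-1 * z))%g = T (x^-1 * z)%g.
Proof.
move=> OC Cx Cy Cz.
have -> : (x^-1 * z = x^-1 * y * (y^-1 * z))%g by rewrite -!mulgA mulVKg.
rewrite (@hT (x^-1 * y)%g)//;
  exact: generated_setsqr (hull_differences hLam T1 dLam OC _ _).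
Qed.

Lemma measurable_hull : measurable (Om : set (borel (closedSpace G))).
Proof. by apply: borel_closed; exact: closed_extended_hull. Qed.

Lemma measurable_set1_empty :
  measurable ([set closed_empty G] : set (borel (closedSpace G))).
Proof.
have -> : [set closed_empty G] = ~` [set C | sval C `&` setT !=set0].
  apply/seteqP; split=> [_ -> [x []]//|C /= nC].
  apply: (eq_sig_hprop (fun _ => @Prop_irrelevance _)).
  apply: contrapT => C0; apply: nC.
  by rewrite setIT; apply/set0P/eqP.
by apply: measurableC; apply: borel_open; apply: open_meets; exact: openT.
Qed.

(** T need not be measurable, so it can enter a measurable condition only
    through countably many of its values: split according to the element
    l = x^-1 s(C) of the countable set Lam^2. As U is separating, the condition
    that s(C) = x l for a point x of C in U can be tested by C meeting U and
    s(C) being in U l. *)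
Lemma measurable_hits_separating Z U : open Z -> open U -> separating Lam U ->
  measurable (hits (marked Z) U).
Proof.
move=> oZ oU sU.
pose D := Om `\ closed_empty G : set (borel (closedSpace G)).
have mD : measurable D.
  by apply: measurableD; [exact: measurable_hull|exact: measurable_set1_empty].
pose E (l : G) : set (borel (closedSpace G)) :=
  (D `&` s @^-1` setmulg U [set l]) `&` (Om `&` phi @^-1` ltrans (T l)^-1%g Z).
have mE l : measurable (E l).
  apply: measurableI.
    by apply: (hs.1 mD); apply: borel_open; exact: open_setmulgl.
  apply: (phi_meas measurable_hull); apply: borel_open; exact: open_ltrans.
have -> : hits (marked Z) U =
    [set C | sval C `&` U !=set0] `&` \bigcup_(l in setsqr Lam) E l.
  apply/seteqP; split=> C.
    move=> [x [[OC Cx Zx] Ux]]; split; first by exists x.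
    have C0 : C <> closed_empty G by move=> C0; rewrite C0 in Cx.
    have Cs : sval C (s C) by exact: hs.2.
    exists (x^-1 * s C)%g; first exact: hull_differences OC Cx Cs.
    split; split=> //=.
      by exists x => //; exists (x^-1 * s C)%g; rewrite ?mulVKg.
    by exists (T (x^-1 * s C) * phi C)%g; rewrite ?mulKg.
  move=> [[x [Cx Ux]] [l Ll [[[OC C0] /= [u Uu [_ -> ul]]] [_ [z Zz zl]]]]].
  have Cs : sval C (s C) by exact: hs.2.
  (* x and u = s(C) l^-1 are both in U and differ by an element of Lam^4. *)
  have xu : x = u.
    apply: sU => //; exists (x^-1 * s C)%g; first exact: hull_differences OC Cx Cs.
    by exists l^-1%g; [exact: setsqrV|rewrite -ul !mulgA mulgK].
  exists x; split=> //; split=> //.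
  by rewrite -ul xu mulKg -zl mulVKg.
apply: measurableI; first by apply: borel_open; exact: open_meets.
have /countable_injP[f fI] := countable_setsqr hLam T1 dLam hb.
have -> : \bigcup_(l in setsqr Lam) E l =
    \bigcup_i \bigcup_(l in [set l | setsqr Lam l /\ f l = i]) E l.
  apply/seteqP; split=> C [].
    by move=> l Ll El; exists (f l) => //; exists l.
  by move=> i _ [l [Ll _] El]; exists l.
apply: bigcup_measurable => i _.
have [[l [Ll fl]]|nl] := pselect (exists l, setsqr Lam l /\ f l = i); last first.
  by rewrite bigcup0// => l li; case: nl; exists l.
have -> : [set l | setsqr Lam l /\ f l = i] = [set l].
  apply/seteqP; split=> [l' [Ll' fl']|_ -> //]; apply: fI; rewrite ?inE//.
  by rewrite fl.
by rewrite bigcup_set1.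
Qed.

Lemma measurable_hits Z S : open Z -> open S -> measurable (hits (marked Z) S).
Proof.
move=> oZ oS; have [U [oU U1 sU]] := exists_separating hLam T1 dLam.
have [bo bN] := hb.
have -> : hits (marked Z) S =
    \bigcup_(i in [set i | b i `<=` S /\ separating Lam (b i)]) hits (marked Z) (b i).
  apply/seteqP; split=> C; last first.
    by move=> [i [biS _]] [x [Cx bix]]; exists x; split=> //; exact: biS.
  move=> [x [Cx Sx]].
  have xU : nbhs x (S `&` ltrans x U).
    apply: open_nbhs_nbhs; split; first by apply: openI => //; exact: open_ltrans.
    by split=> //; exists 1%g; rewrite ?mulg1.
  have [i [bix biS]] := bN _ _ xU; exists i; last by exists x.
  split; first by move=> y /biS[].
  apply: (separatingS (V := ltrans x U)); last exact: separating_ltrans.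
  by move=> y /biS[].
apply: bigcup_measurable => i [_ si].
exact: measurable_hits_separating.
Qed.

Lemma ae_hull : \forall C \ae nu, Om C.
Proof.
exists (~` Om); split=> //; first by apply: measurableC; exact: measurable_hull.
by rewrite probability_setC ?nu_hull ?subee//; exact: measurable_hull.
Qed.

(** For almost every C the transported value at the point g x of g C is that
    at the point x of C multiplied on the right by beta(g, C)^-1, an element
    of L; since Z L = Z, the marked points of g C are the translates of those
    of C. *)
Lemma stationary_hits Z g S : (forall z l, Z z -> L l -> Z (z * l)%g) ->
  open Z -> open S ->
  nu (hits (marked Z) (ltrans g S)) = nu (hits (marked Z) S).
Proof.
move=> ZL oZ oS.
have mgS : measurable (hits (marked Z) (ltrans g S)).
  by apply: measurable_hits => //; exact: open_ltrans.
rewrite -(nu_inv g mgS); apply: measure_ae_eq.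
- rewrite -[_ @^-1` _]setTI.
  exact: (borel_continuous (@translate_continuous G g)).
- exact: measurable_hits.
have [_ _ LV] := hL.
have aeF : Filter (almost_everywhere nu) by exact: ae_filter_ringOfSetsType.
have aeI := @filterI _ _ aeF _ _ ae_hull (phi_coh g).
apply: (@filterS _ _ aeF _ _ _ aeI) => C [OC cohC].
have OgC : Om (translate g C) by exact: extended_hull_translate.
(* With z = g^-1 s(g C), a point of C, the cocycle at (g, C) is z^-1 s(C), and
   T (x^-1 z) T (z^-1 s(C)) = T (x^-1 s(C)). *)
have key x : sval C x ->
    (T ((g * x)^-1 * s (translate g C)) * phi (translate g C) =
     T (x^-1 * s C) * phi C * (beta g C)^-1)%g.
  move=> Cx.
  have C0 : C <> closed_empty G by move=> C0; rewrite C0 in Cx.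
  have gC0 : translate g C <> closed_empty G.
    move=> gC0; have : sval (translate g C) (g * x)%g by exists x.
    by rewrite gC0.
  have Cs : sval C (s C) by exact: hs.2.
  have [z Cz gz] : sval (translate g C) (s (translate g C)) by exact: hs.2.
  rewrite -gz invgM -mulgA mulKg.
  have -> : phi (translate g C) = (T (z^-1 * s C) * phi C * (beta g C)^-1)%g.
    move: cohC; rewrite /section_cocycle -gz invgM mulgVK => ->.
    by rewrite !mulgVK mulgK.
  by rewrite !mulgA (T_difference OC Cx Cz Cs).
split.
  move=> [_ [[_ [x Cx <-] Zgx] [y Sy /mulgI yx]]]; rewrite yx in Sy.
  exists x; split=> //; split=> //.
  by rewrite -[X in Z X](mulgVK (beta g C)) -key//; apply: ZL => //; exact: beta_L.
move=> [x [[_ Cx Zx] Sx]]; exists (g * x)%g; split; last by exists x.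
split=> //; first by exists x.
by rewrite key//; apply: ZL => //; apply: LV; exact: beta_L.
Qed.

(** Take for Lam' the largest subset of Lam^2 that the last condition allows;
    it contains all differences of marked points for Z = W h L, and these
    cover Lam up to finitely many translates. *)
Lemma cocycle_reduction : exists h : H, forall V : set H, nbhs (1%g : H) V ->
  exists Lam' : set G,
    [/\ Lam' `<=` setmulg Lam Lam, commensurable Lam' Lam
      & T @` Lam' `<=`
          setmulg (setmulg V [set (h * l * h^-1)%g | l in L]) (setinvg V)].
Proof.
have [L1 LM LV] := hL.
have nuO : nu Om != 0 by rewrite nu_hull oner_neq0.
have [h hP] := exists_support_point hc measurable_hull phi_meas nuO.
exists h => V; rewrite nbhsE => -[W [oW W1] WV].
pose hLh := [set (h * l * h^-1)%g | l in L].
exists (setsqr Lam `&` T @^-1` setmulg (setmulg V hLh) (setinvg V)); split.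
- by move=> x [].
- apply: (commensurable_of_cover hLam); first by move=> x [].
    move=> x [L2x [_ [v Vv [_ [l Ll <-] <-]] [_ [w Vw <-] vw]]].
    have L2x' := setsqrV hLam L2x; split=> //=.
    have -> : T (x^-1)%g = ((T x)^-1)%g.
      apply: (mulgI (T x)); rewrite -hT; try exact: generated_setsqr.
      by rewrite !mulgV (generated_hom1 hT).
    rewrite -vw; exists (w * (h * l^-1 * h^-1))%g.
      exists w => //; exists (h * l^-1 * h^-1)%g => //.
      by exists (l^-1)%g => //; exact: LV.
    by exists (v^-1)%g; [exists v|rewrite !invgM !invgK !mulgA].
  pose Z := setmulg W [set (h * l)%g | l in L].
  have oZ : open Z by exact: open_setmulgl.
  have ZL z l : Z z -> L l -> Z (z * l)%g.
    move=> [w Ww [_ [m Lm <-] <-]] Ll; exists w => //.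
    by exists (h * (m * l))%g; [exists (m * l)%g => //; exact: LM|rewrite !mulgA].
  have [U [oU U1 sU]] := exists_separating hLam T1 dLam.
  have /mulg_near[A1 [A2 [oA1 A11 oA2 A21 AU]]] : nbhs (1 * 1 : G)%g U.
    by rewrite mulg1; exact: open_nbhs_nbhs.
  apply: (@return_set_covers _ _ _ nu G b hb (marked Z) _ _ _ Lam _
    (A1 `&` A2) U) => //.
  + by move=> S oS; exact: measurable_hits.
  + by move=> g S oS; exact: stationary_hits.
  (* The point s(C) is marked as soon as phi(C) is in W h. *)
  + apply: lt_le_trans (hP W oW W1) _.
    have mW : measurable
        (Om `&` phi @^-1` setmulg W [set h] : set (borel (closedSpace G))).
      apply: phi_meas; first exact: measurable_hull.
      by apply: borel_open; exact: open_setmulgl.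
    have mZ : measurable (hits (marked Z) setT).
      by apply: measurable_hits => //; exact: openT.
    apply: measure_ae_le => //.
    have aeF : Filter (almost_everywhere nu) by exact: ae_filter_ringOfSetsType.
    have aeN : \forall C \ae nu, C <> closed_empty G.
      exists [set closed_empty G]; split=> //; first exact: measurable_set1_empty.
      by move=> C /= /contrapT.
    apply: (@filterS _ _ aeF _ _ _ aeN) => C C0 [OC [w Ww [_ -> wh]]].
    have Cs : sval C (s C) by exact: hs.2.
    exists (s C); split=> //; split=> //.
    rewrite mulVg (generated_hom1 hT) mul1g -wh; exists w => //.
    by exists h => //; exists 1%g; rewrite ?mulg1.
  + by move=> f; exact: (approxV hLam).
  + exact: openI.
  + by move=> _ [a [Aa _] [a' [_ Aa'] <-]]; apply: AU; exists a => //; exists a'.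
  + move=> C x y f g [OC Cx _] [_ Cy _] Lf Lg Uxf Uyg; apply: sU => //.
    have [p Lp [q Lq pq]] := hull_differences hLam T1 dLam OC Cx Cy.
    exists (f^-1 * p)%g.
      by exists (f^-1)%g; [exact: (approxV hLam)|exists p].
    exists (q * g)%g; first by exists q => //; exists g.
    by rewrite invgM -!mulgA (mulgA p) pq !mulgA.
  + move=> C x y [OC Cx [w Ww [_ [l Ll <-] wx]]] [_ Cy [v Wv [_ [m Lm <-] vy]]].
    split; first exact: hull_differences OC Cx Cy.
    have C0 : C <> closed_empty G by move=> C0; rewrite C0 in Cx.
    have Cs : sval C (s C) by exact: hs.2.
    rewrite /= -[T _](mulgK (T (y^-1 * s C)%g * phi C)%g) mulgA.
    rewrite (T_difference OC Cx Cy Cs) -wx -vy.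
    exists (w * (h * (l * m^-1) * h^-1))%g; last first.
      by exists (v^-1)%g; [exists v => //; exact: WV|rewrite !invgM !mulgA].
    exists w; first exact: WV.
    exists (h * (l * m^-1) * h^-1)%g => //; exists (l * m^-1)%g => //.
    by apply: LM => //; exact: LV.
by move=> _ [x [_ Tx] <-].
Qed.

End CocycleReduction.

(** * Local fields and groups of rational points *)

Section LocalField.
Variable k : topFieldType.
Hypothesis hk : local_field k.
Local Open Scope ring_scope.

Lemma local_field_compact_nbhs : exists V : set k, nbhs 0 V /\ compact V.
Proof.
have [_ lck _] := hk; have [V V0 [cV _]] := lck 0 I.
by exists V; split=> //; rewrite withinET in V0.
Qed.

Lemma local_field_nbhs_nonzero (N : set k) : nbhs 0 N -> exists2 x, N x & x != 0.
Proof.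
move=> N0; apply: contrapT => nx; have [_ _] := hk; apply.
rewrite openE => _ ->; apply: filterS N0 => x Nx /=.
by apply: contrapT => /eqP x0; apply: nx; exists x.
Qed.

Lemma mulf_nbhs (x y : k) (S : set k) : nbhs (x * y) S ->
  exists U V, [/\ nbhs x U, nbhs y V & forall u v, U u -> V v -> S (u * v)].
Proof.
move=> /(@mulf_continuous k (x, y))[[U V] /= [xU yV] UV].
by exists U, V; split=> // u v Uu Vv; exact: (UV (u, v)).
Qed.

Lemma mulfl_continuous (a : k) : continuous (fun x : k => a * x).
Proof.
move=> x S /mulf_nbhs[U [V [aU xV UV]]].
by apply: filterS xV => y; apply: UV; exact: nbhs_singleton.
Qed.

Lemma mulfr_continuous (a : k) : continuous (fun x : k => x * a).
Proof.
move=> x S /mulf_nbhs[U [V [xU aV UV]]].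
by apply: filterS xU => y Uy; apply: UV => //; exact: nbhs_singleton.
Qed.

(** The product 0 v = 0 lies in N for every v; by compactness of V one
    neighbourhood of 0 works for all v in V. *)
Lemma near0_mul_compact (V N : set k) : compact V -> nbhs 0 N ->
  \forall a \near 0, forall v, V v -> N (a * v).
Proof.
move=> /compact_near_coveringP cV N0.
apply: (cV k (nbhs 0) (fun a v => N (a * v))) => v Vv.
have /mulf_nbhs[U [W [U0 Wv UW]]] : nbhs (0 * v) N by rewrite mul0r.
by exists (W, U) => //= -[w u] [/= Ww Uu]; exact: UW.
Qed.

Lemma local_field_T1 (x : k) : closed [set x].
Proof.
have [hdf _ _] := hk.
exact: accessible_closed_set1 (hausdorff_accessible hdf) x.
Qed.

(** Take a nonzero a so small that a V is contained in V and misses a point of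
    V, for a compact neighbourhood V of 0. For a nonzero v1 in V, the elements
    a^n v1 stay in V and have a cluster point p. If p = 0, the powers of a
    come arbitrarily close to 0. If p is invertible, quotients of terms close
    to p show that 1 is a limit of positive powers of a, all of which map V
    into the closed set a V; then V is contained in a V, a contradiction. *)
Lemma exists_topologically_nilpotent : exists a : k, a != 0 /\
  forall N, nbhs 0 N -> exists n, N (a ^+ n).
Proof.
have [hdf _ _] := hk.
have [V [V0 cV]] := local_field_compact_nbhs.
have [v1 Vv1 v10] := local_field_nbhs_nonzero V0.
(* As a tends to 0, a V shrinks to 0, so it ends up missing v1. *)
have [a [a0 aV [v0 Vv0 av0]]] : exists a : k, [/\ a != 0,
    forall v, V v -> V (a * v) & exists2 v, V v & ~ exists2 u, V u & a * u = v].
  have n1 := near0_mul_compact cV V0.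
  have n2 : \forall a \near 0, forall v, V v -> a * v != v1.
    apply: (@near0_mul_compact V [set x | x != v1] cV).
    apply: open_nbhs_nbhs; split; last by rewrite /= eq_sym.
    rewrite -closedC (_ : ~` _ = [set v1]); first exact: local_field_T1.
    apply/seteqP; split=> x /=; last by move=> ->; rewrite eqxx.
    by move=> /negP; rewrite negbK => /eqP.
  have [a [a1 a2] a0] := local_field_nbhs_nonzero (filterI n1 n2).
  exists a; split=> //; exists v1 => // -[u Vu auv].
  by have := a2 u Vu; rewrite auv eqxx.
exists a; split=> // N N0.
pose x n := a ^+ n * v1.
have Vx n : V (x n).
  by elim: n => [|n IH]; rewrite /x ?mul1r// exprS -mulrA; exact: aV.
have [p [Vp clp]] : V `&` cluster (x @ \oo) !=set0.
  by apply: cV; exists 0%N => // n _; exact: Vx.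
have freq (B : set k) m : nbhs p B -> exists2 n, (m <= n)%N & B (x n).
  move=> pB.
  have [|y [[n mn <-] Bn]] := clp [set x n | n in [set n | (m <= n)%N]] B _ pB.
    by exists m => // n mn; exists n.
  by exists n.
have [p0|p0] := eqVneq p 0.
  have [|n _ Bn] := freq [set y | N (y * v1^-1)] 0%N.
    by rewrite p0; apply: mulfr_continuous; rewrite mul0r.
  by exists n; move: Bn; rewrite /= /x mulfK.
case: av0.
pose aV' := (fun u => a * u) @` V.
have caV : closed aV'.
  apply: compact_closed => //; apply: continuous_compact cV.
  by apply: continuous_subspaceT => u; exact: mulfl_continuous.
suff : aV' v0 by [].
apply: caV => O v0O.
have M1 : nbhs (1 : k) [set t | O (t * v0)].
  by apply: mulfr_continuous; rewrite mul1r.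
have /mulf_nbhs[U [W [pU pW UW]]] : nbhs (p * p^-1) [set t | O (t * v0)].
  by rewrite mulfV.
have pB : nbhs p (U `&` [set y | W y^-1]).
  by apply: filterI => //; exact: invf_continuous.
have [n1 _ [_ Wn1]] := freq _ 0%N pB.
have [n2 n12 [Un2 _]] := freq _ n1.+1 pB.
have := UW _ _ Un2 Wn1 => /=.
have -> : x n2 / x n1 = a * a ^+ (n2 - n1).-1.
  rewrite /x -exprS prednK ?subn_gt0// invfM mulrACA mulfV// mulr1.
  by rewrite expfB// ltnW.
rewrite -mulrA => On; exists (a * (a ^+ (n2 - n1).-1 * v0)); split=> //.
exists (a ^+ (n2 - n1).-1 * v0) => //.
by elim: (n2 - n1).-1 => [|m IH]; rewrite ?mul1r// exprS -mulrA; exact: aV.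
Qed.

Lemma addf_nbhs (x y : k) (S : set k) : nbhs (x + y) S ->
  exists U V, [/\ nbhs x U, nbhs y V & forall u v, U u -> V v -> S (u + v)].
Proof.
move=> /(@add_continuous k (x, y))[[U V] /= [xU yV] UV].
by exists U, V; split=> // u v Uu Vv; exact: (UV (u, v)).
Qed.

Lemma addfr_continuous (c : k) : continuous (fun x : k => x + c).
Proof.
move=> x S /addf_nbhs[U [V [xU cV UV]]].
by apply: filterS xU => y Uy; apply: UV => //; exact: nbhs_singleton.
Qed.

Lemma addfl_continuous (c : k) : continuous (fun x : k => c + x).
Proof.
move=> x S /addf_nbhs[U [V [cU xV UV]]].
by apply: filterS xV => y; apply: UV; exact: nbhs_singleton.
Qed.

(** The base consists of translates q + a^n V' of multiples of the interior V'
    of a compact neighbourhood V of 0, where for each n and m finitely many q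
    are chosen so that these translates cover the compact set a^-m V. *)
Lemma local_field_countable_base : exists b : nat -> set k, countable_base b.
Proof.
have [V [V0 cV]] := local_field_compact_nbhs.
have [a [a0 aN]] := exists_topologically_nilpotent.
pose D n := [set x | (interior V) ((a ^+ n)^-1 * x)].
have an0 n : a ^+ n != 0 by exact: expf_neq0.
have oD n (q : k) : open [set x | D n (x - q)].
  apply: (@open_comp _ _ (fun x : k => (a ^+ n)^-1 * (x - q)) (interior V)).
    move=> x _; apply: (@continuous_comp _ _ _ (fun x : k => x - q)
      (fun x : k => (a ^+ n)^-1 * x)); first exact: addfr_continuous.
    exact: mulfl_continuous.
  exact: open_interior.
have /choice[l lP] : forall nm : nat * nat, exists l : seq k, forall x,
    V (a ^+ nm.2 * x) -> exists2 q, q \in l & D nm.1 (x - q).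
  move=> [n m] /=.
  pose K := (fun v => (a ^+ m)^-1 * v) @` V.
  have cK : compact K.
    apply: continuous_compact cV; apply: continuous_subspaceT => v.
    exact: mulfl_continuous.
  (* Finite subcovers are extracted by convergence along the finite lists ordered
   by inclusion: each point of K is covered near it by all lists containing
   it. *)
  pose F := filter_from [set: seq k] (fun l0 => [set l : seq k | {subset l0 <= l}]).
  have FF : Filter F.
    apply: filter_from_filter; first by exists [::].
    move=> l1 l2 _ _; exists (l1 ++ l2) => // l l12.
    by split=> q ql; apply: l12; rewrite mem_cat ql ?orbT.
  move/compact_near_coveringP : cK.
  move=> /(_ _ F (fun l x => exists2 q, q \in l & D n (x - q)) FF)[].
    move=> x _; exists ([set y | D n (y - x)], [set l : seq k | x \in l]) => /=.
      split; last by exists [:: x] => // l /(_ x); apply; exact: mem_head.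
      apply: open_nbhs_nbhs; split; first exact: oD.
      by rewrite /= subrr /D /= mulr0; exact: V0.
    by move=> [y l] /= [Dyx xl]; exists x.
  move=> l0 _ l0P; exists l0 => x Vx; apply: l0P => //.
  by exists (a ^+ m * x) => //; rewrite mulKf.
apply: (@countable_base_reindex k (nat * nat * nat)%type
  (fun i => [set x | D i.1.1 (x - nth 0 (l i.1) i.2)])) => [i|x S xS].
  exact: oD.
have /addf_nbhs[U1 [U2 [U10 U20 U12]]] : nbhs (0 + 0 : k) [set y | S (x + y)].
  by rewrite addr0; apply: addfl_continuous; rewrite addr0.
have N0 : nbhs (0 : k) (U1 `&` [set z | U2 (- z)]).
  by apply: filterI => //; apply: (@opp_continuous k 0); rewrite oppr0.
have [n nP] := aN _ (near0_mul_compact cV N0).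
have DN y : D n y -> U1 y /\ U2 (- y).
  by move=> /interior_subset Vy; have := nP _ Vy; rewrite mulVKf.
have [m mP] : exists m, V (a ^+ m * x).
  by apply: (aN [set t | V (t * x)]); apply: mulfr_continuous; rewrite mul0r.
have [q ql Dxq] := lP (n, m) x mP.
exists (n, m, index q (l (n, m))) => /=; rewrite nth_index//; split=> // y Dyq.
have -> : y = x + ((y - q) - (x - q)) by rewrite opprB subrKA addrC subrK.
by apply: U12; [have [] := DN _ Dyq|have [] := DN _ Dxq].
Qed.

End LocalField.

Lemma matrix_countable_base (k : topologicalType) (b : nat -> set k) m n :
  countable_base b -> exists c : nat -> set 'M[k]_(m, n), countable_base c.
Proof.
move=> hb; apply: (@finite_initial_countable_base 'M[k]_(m, n) ('I_m * 'I_n)%type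
  (fun=> k) (fun ij M => M ij.1 ij.2) (fun=> b)) => //.
  by move=> [i j]; exact: mx_entry_continuous.
move=> M S [Q MQ QS]; exists (fun ij => Q ij.1 ij.2); split=> [ij|N NQ].
  exact: MQ.
by apply: QS => i j; exact: (NQ (i, j)).
Qed.

Section RationalPoints.
Variables (k : topFieldType) (K : closedFieldType) (iota : {rmorphism k -> K}).
Variables (n : nat) (G : algebraic_group iota n).

Lemma rational_point_countable_base : local_field k ->
  exists c : nat -> set (rational_point G), countable_base c.
Proof.
move=> /local_field_countable_base[b /(matrix_countable_base n n)[c hc]].
apply: (@finite_initial_countable_base (rational_point G) unit (fun=> 'M[k]_n)
  (fun=> \val) (fun=> c)) => // [_|x S].
  exact: val_point_continuous.
rewrite nbhsE => -[_ [[B oB <-] Bx] BS]; exists (fun=> B); split.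
  by move=> _; apply: open_nbhs_nbhs; split=> //; rewrite set_valE in Bx.
by move=> y /(_ tt) By; apply: BS; rewrite /= set_valE.
Qed.

Lemma rational_point_T1 : local_field k -> accessible_space (rational_point G).
Proof.
move=> [/hausdorff_accessible T1 _ _].
apply: (@accessible_of_separating (rational_point G) ('I_n * 'I_n)%type
  (fun=> k) (fun ij x => (\val x : 'M[k]_n) ij.1 ij.2)) => //.
  by move=> [i j]; apply: continuous_entry; exact: val_point_continuous.
by move=> x y xy; apply/val_inj/matrixP => i j; exact: (xy (i, j)).
Qed.

End RationalPoints.

Section Products.
Variables (I : finType) (G : I -> topGroupType).

(** The boxes around x generate a filter that converges to x in each coordinate
    topology, hence in their supremum: every neighbourhood contains a box. *)
Lemma product_group_countable_base (b : forall i, nat -> set (G i)) :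
  (forall i, countable_base (b i)) ->
  exists c : nat -> set (product_group G), countable_base c.
Proof.
move=> hb; apply: (@finite_initial_countable_base (product_group G) I G
  (fun i x => x i) b) => //; first exact: coordinate_continuous.
move=> x S.
pose F : set_system (product_group G) := [set S | exists B : forall i, set (G i),
  (forall i, nbhs (x i) (B i)) /\ forall y, (forall i, B i (y i)) -> S y].
have FF : Filter F.
  split.
  - by exists (fun i => setT); split=> // i; exact: filterT.
  - move=> P Q [B [xB BP]] [C [xC CQ]]; exists (fun i => B i `&` C i).
    split=> [i|y By]; first exact: filterI.
    by split; [apply: BP|apply: CQ] => i; have [] := By i.
  - by move=> P Q PQ [B [xB BP]]; exists B; split=> // y /BP/PQ.
have Fx : F --> (x : product_topology_def G).
  apply/cvg_sup => i; move=> U; rewrite nbhsE => -[_ [[B oB <-] Bx] BU].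
  exists (dfwith (T := fun j => set (G j)) (fun=> setT) i B); split=> [j|y yB].
    case: dfwithP => [|j' _]; last exact: filterT.
    exact: open_nbhs_nbhs.
  by apply: BU => /=; have := yB i; rewrite dfwithin.
exact: Fx.
Qed.

Lemma product_group_T1 :
  (forall i, accessible_space (G i)) -> accessible_space (product_group G).
Proof.
move=> T1; apply: (@accessible_of_separating (product_group G) I G
  (fun i x => x i)) => //; first exact: coordinate_continuous.
by move=> x y xy; exact: functional_extensionality_dep.
Qed.

End Products.

Theorem theorem3 (R : realType) (A : finType)
    (k : A -> topFieldType) (K : A -> closedFieldType)
    (iota : forall a, {rmorphism k a -> K a}) (n r : A -> nat)
    (GG : forall a, algebraic_group (iota a) (n a))
    (hk : forall a, local_field (k a))
    (hchar : forall a, [pchar k a]%R =i pred0)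
    (hsimple : forall a, almost_simple (GG a))
    (hrank : forall a, is_rank (GG a) (r a))
    (hrank2 : forall a, (2 <= r a)%N)
    (Lambda : set (product_of_points GG))
    (hLambda : star_approximate_lattice R Lambda)
    (nu : probability (borel (closedSpace (product_of_points GG))) R)
    (hnu1 : nu (extended_hull Lambda) = 1%E)
    (hnu_proper : proper_measure nu)
    (hnu_inv : invariant_measure nu)
    (hnu_erg : ergodic_measure nu)
    (s : closedSpace (product_of_points GG) -> product_of_points GG)
    (hs : pointed_section (extended_hull Lambda) s)
    (H : topGroupType) (hH : lcsc H)
    (T : product_of_points GG -> H) (hT : hom_on_generated Lambda T)
    (L : set H) (hL : is_subgroup L) (hLc : closed L)
    (hcoh : exists beta : product_of_points GG -> closedSpace (product_of_points GG) -> H,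
      [/\ borel_cocycle (extended_hull Lambda) nu beta,
          values_in (extended_hull Lambda) beta L
        & cohomologous (extended_hull Lambda) nu
            (fun g X => T (section_cocycle s g X)) beta]) :
  exists h : H, forall V : set H, nbhs (1%g : H) V ->
    exists Lambda' : set (product_of_points GG),
      [/\ Lambda' `<=` setmulg Lambda Lambda,
          commensurable Lambda' Lambda
        & T @` Lambda' `<=`
            setmulg (setmulg V [set (h * l * h^-1)%g | l in L]) (setinvg V)].
Proof.
have T1 : accessible_space (product_of_points GG).
  by apply: product_group_T1 => a; exact: rational_point_T1.
have base a := cid (rational_point_countable_base (GG a) (hk a)).
have [b hb] := product_group_countable_base (fun a => projT2 (base a)).
have [_ _ /second_countable_base[d hd]] := hH.
have [approx discrete _] := hLambda.
have [beta [_ beta_L [phi [phi_meas phi_coh]]]] := hcoh.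
exact: (cocycle_reduction T1 hb hd approx discrete hnu1 hnu_proper hnu_inv hs
  hT hL beta_L phi_meas phi_coh).
Qed.
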